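(* Let $k\in\mathbb{N}^*$. Suppose that either $P\in\mathcal{P}^{K,h}(\mathbb{R}^d)$ for some $h\in(0,1]$ and $K>0$, or $P$ is the uniform probability measure on a set of $n$ points of $\mathbb{R}^d$ in general position and $h=\frac{q}{n}$ with $q\in\{1,\dots,n\}$. Then any $k$-PDTM $\mathrm{d}_{P,h,k}$ of $P$ satisfies, for some $\theta=(\theta_1,\dots,\theta_k)\in\mathrm{OPT}(P,h,k)$, $$\mathrm{d}^2_{P,h,k}(x)=\min_{i\in\{1,\dots,k\}}\|x-\theta_i\|^2+\omega^2_{P,h}(\theta_i)\qquad\forall x\in\mathbb{R}^d.$$ Conversely, for all $\theta\in\mathrm{OPT}(P,h,k)$, the function $x\mapsto\sqrt{\min_{i\in\{1,\dots,k\}}\|x-\theta_i\|^2+\omega^2_{P,h}(\theta_i)}$ is a $k$-PDTM of $P$.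
   Context: $\mathbb{R}^d$ carries the Euclidean norm; $B(x,r)$ and $\overline{B}(x,r)$ are the open and closed balls. For a unit vector $v$ and $c\in\mathbb{R}$, $H(v,c)=\{x:\langle x,v\rangle>c\}$. Conventions: $\inf\emptyset=+\infty$, $\sup\emptyset=-\infty$, $B(x,+\infty)=H(v,-\infty)=\mathbb{R}^d$. For a Borel probability measure $P$ with finite second moment: $\delta_{P,l}(x)=\inf\{r>0: P(\overline{B}(x,r))>l\}$; $c_{P,h}(v)=\sup\{c\in\mathbb{R}: P(H(v,c))>h\}$; the distance to measure (DTM) is $\mathrm{d}_{P,h}(x)\ge0$ with $\mathrm{d}^2_{P,h}(x)=\frac1h\int_0^h\delta_{P,l}^2(x)\,dl$. $\mathcal{P}^{K,h}(\mathbb{R}^d)$ is the set of Borel probability measures $P$ with $\mathrm{Supp}(P)\subset\overline{B}(0,K)$ that put no mass on the boundaries of balls of $P$-mass $h$ nor on the boundaries of half-spaces of $P$-mass $h$, i.e. $P(\partial B(x,\delta_{P,h}(x)))=0$ for all $x\in\mathbb{R}^d$ and $P(\partial H(v,c_{P,h}(v)))=0$ for all unit $v$. A finite set of points is in general position if any subset of size at most $d+1$ is affinely independent. Let $\overline{\mathbb{R}}_d=\mathbb{R}^d\cup\{v_\infty: \|v\|=1\}$, where $v_\infty$ is a point at infinity in direction $v$. For $x\in\mathbb{R}^d$, $\mathcal{P}_{x,h}(P)$ is the set of probability measures $P_{x,h}=\frac1h Q$ with $Q$ a sub-measure of $P$ of total mass $h$, coinciding with $P$ on $B(x,\delta_{P,h}(x))$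 and supported on $\overline{B}(x,\delta_{P,h}(x))$. For $x=v_\infty$, $\mathcal{P}_{v_\infty,h}(P)$ is defined in the same way with $H(v,c_{P,h}(v))$ and its closure replacing the open and closed ball. $P_{x,h}$ denotes an element of $\mathcal{P}_{x,h}(P)$; $m(P_{x,h})=\int u\,dP_{x,h}(u)$, $v(P_{x,h})=\int\|u-m(P_{x,h})\|^2dP_{x,h}(u)$. For a set $A$, $A^{(k)}$ is the set of $k$-tuples of elements of $A$ up to permutation. $\mathcal{O}pt(P,h,k)$ is the set of $t\in\overline{\mathbb{R}}_d^{(k)}$ minimizing $\int\min_{i}(\|u-m(P_{t_i,h})\|^2+v(P_{t_i,h}))\,dP(u)$ (when $\mathcal{P}_{t_i,h}(P)$ is not a singleton, the minimization is over $t$ and over the choices of $P_{t_i,h}\in\mathcal{P}_{t_i,h}(P)$). A $k$-PDTM of $P$ is a nonnegative function $\mathrm{d}_{P,h,k}$ given, for some minimizer $s\in\mathcal{O}pt(P,h,k)$ (with its minimizing choice of $P_{s_i,h}$), by $\mathrm{d}^2_{P,h,k}(x)=\min_{i}\|x-m(P_{s_i,h})\|^2+v(P_{s_i,h})$. For $\tau\in\mathbb{R}^d$, $\omega_{P,h}(\tau)=\inf\{\omega>0:\ \forall x\in\mathbb{R}^d,\ \|x-\tau\|^2+\omega^2\ge\mathrm{d}^2_{P,h}(x)\}$, equivalently $\omega_{P,h}^2(\tau)=\sup_{x\in\mathbb{R}^d}\mathrm{d}^2_{P,h}(x)-\|x-\tau\|^2$. $\mathrm{OPT}(P,h,k)$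 is the set of $\tau=(\tau_1,\dots,\tau_k)\in(\mathbb{R}^d)^{(k)}$ minimizing $\int\min_{i}(\|u-\tau_i\|^2+\omega^2_{P,h}(\tau_i))\,dP(u)$. *)

(* Defs.v *)
From HB Require Import structures.
From mathcomp Require Import all_boot all_order all_algebra.
From mathcomp Require Import all_classical all_reals all_analysis.
Set Implicit Arguments.
Unset Strict Implicit.
Unset Printing Implicit Defensive.
Import Order.TTheory GRing.Theory Num.Theory.
Import numFieldNormedType.Exports.

Local Open Scope classical_set_scope.
Local Open Scope ring_scope.

(* R^d with its Borel sigma-algebra.  The library norm on ['rV[R]_d] is the
   sup norm, which has the same open sets as the Euclidean norm [enorm]. *)
Definition borel_rV (R : realType) (d : nat) :=
  g_sigma_algebraType (@open 'rV[R]_d).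

Section euclidean.
Context {R : realType} {d : nat}.
Implicit Types (u v x y : 'rV[R]_d).

Definition dot u v : R := \sum_(j < d) u 0 j * v 0 j.

Definition enorm u : R := Num.sqrt (dot u u).

(* Radii and levels are extended reals, so that
   [eball x +oo = ecball x +oo = halfspace v -oo = setT]. *)
Definition eball x (r : \bar R) : set 'rV[R]_d :=
  [set y | ((enorm (y - x))%:E < r)%E].

Definition ecball x (r : \bar R) : set 'rV[R]_d :=
  [set y | ((enorm (y - x))%:E <= r)%E].

Definition halfspace v (c : \bar R) : set 'rV[R]_d :=
  [set y | (c < (dot y v)%:E)%E].

Definition chalfspace v (c : \bar R) : set 'rV[R]_d :=
  [set y | (c <= (dot y v)%:E)%E].

Definition boundary (A : set 'rV[R]_d) : set 'rV[R]_d := closure A `\` A°.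

Definition affinely_independent n (p : 'I_n -> 'rV[R]_d) (A : {set 'I_n}) :=
  forall w : 'I_n -> R,
    \sum_(i in A) w i = 0 -> \sum_(i in A) w i *: p i = 0 ->
    forall i, i \in A -> w i = 0.

Definition general_position n (p : 'I_n -> 'rV[R]_d) :=
  forall A : {set 'I_n}, (#|A| <= d.+1)%N -> affinely_independent p A.

(* The completion of R^d by the points at infinity [v_oo], [v] a unit vector. *)
Definition extended_space := ('rV[R]_d + {v : 'rV[R]_d | enorm v = 1})%type.

(* [x |-> min_i (|x - c_i|^2 + w_i)] for centres [c_i] and weights [w_i]. *)
Definition power_dist2 k (c : 'I_k -> 'rV[R]_d) (w : 'I_k -> \bar R) x : \bar R :=
  \big[Order.min/+oo%E]_(i < k) (((enorm (x - c i)) ^+ 2)%:E + w i)%E.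

End euclidean.
Arguments extended_space : clear implicits.

Section measures.
Context {R : realType} {d : nat}.
Implicit Types (P mu : probability (borel_rV R d) R) (h : R).
Implicit Types (x v tau : 'rV[R]_d) (t : extended_space R d).

Definition supp P : set 'rV[R]_d :=
  [set x | forall U : set 'rV[R]_d, open U -> U x -> (0 < P U)%E].

Definition delta P (l : R) x : \bar R :=
  ereal_inf [set r%:E | r in
    [set r : R | 0 < r /\ (l%:E < P (ecball x r%:E))%E]].

Definition cut P h v : \bar R :=
  ereal_sup [set c%:E | c in [set c : R | (h%:E < P (halfspace v c%:E))%E]].

(* The square of the distance to measure; it can be infinite. *)
Definition dtm2 P h x : \bar R :=
  ((h^-1)%:E * \int[lebesgue_measure]_(l in `[0%R, h]) (delta P l x ^+ 2))%E.

Definition regular_class (K h : R) P :=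
  [/\ supp P `<=` ecball 0 K%:E,
      forall x, P (boundary (eball x (delta P h x))) = 0%E &
      forall v, enorm v = 1 -> P (boundary (halfspace v (cut P h v))) = 0%E].

Definition uniform_on n (p : 'I_n -> 'rV[R]_d) P :=
  forall A : set (borel_rV R d), measurable A ->
    P A = ((n%:R^-1)%:E * \sum_(i < n) \d_(p i : borel_rV R d) A)%E.

Definition local_region P h t : set 'rV[R]_d :=
  match t with
  | inl x => eball x (delta P h x)
  | inr v => halfspace (sval v) (cut P h (sval v))
  end.

Definition local_cregion P h t : set 'rV[R]_d :=
  match t with
  | inl x => ecball x (delta P h x)
  | inr v => chalfspace (sval v) (cut P h (sval v))
  end.

(* The set of all [P_{t,h} = Q / h]. *)
Definition local_probs P h t : set (probability (borel_rV R d) R) :=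
  [set mu : probability (borel_rV R d) R |
    exists Q : {measure set (borel_rV R d) -> \bar R},
    [/\ forall A : set (borel_rV R d), measurable A -> (Q A <= P A)%E,
        Q setT = h%:E,
        forall A : set (borel_rV R d), measurable A ->
          A `<=` local_region P h t -> Q A = P A,
        Q (~` local_cregion P h t) = 0%E &
        forall A : set (borel_rV R d), measurable A ->
          mu A = ((h^-1)%:E * Q A)%E]].

Definition mean mu : 'rV[R]_d := \row_j \int[mu]_u (u : 'rV[R]_d) 0 j.

Definition var mu : \bar R :=
  \int[mu]_u ((enorm ((u : 'rV[R]_d) - mean mu)) ^+ 2)%:E.

Definition risk P k (c : 'I_k -> 'rV[R]_d) (w : 'I_k -> \bar R) : \bar R :=
  \int[P]_u power_dist2 c w u.

(* [k]-tuples up to permutation are represented by functions on ['I_k]: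
   everything below is invariant under permutation of the indices. *)

(* [s] minimizes the risk, with the minimizing choices [mu i] of [P_{s_i,h}]. *)
Definition pdtm_optimal P h k (s : 'I_k -> extended_space R d)
    (mu : 'I_k -> probability (borel_rV R d) R) :=
  (forall i, local_probs P h (s i) (mu i)) /\
  forall (t : 'I_k -> extended_space R d)
         (nu : 'I_k -> probability (borel_rV R d) R),
    (forall i, local_probs P h (t i) (nu i)) ->
    (risk P (mean \o mu) (var \o mu) <= risk P (mean \o nu) (var \o nu))%E.

Definition is_pdtm P h k (f : 'rV[R]_d -> R) :=
  exists (s : 'I_k -> extended_space R d)
         (mu : 'I_k -> probability (borel_rV R d) R),
    pdtm_optimal P h s mu /\
    forall x, 0 <= f x /\
      ((f x) ^+ 2)%:E = power_dist2 (mean \o mu) (var \o mu) x.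

Definition omega P h tau : \bar R :=
  ereal_inf [set w%:E | w in [set w : R | 0 < w /\
    forall x, (dtm2 P h x <= ((enorm (x - tau)) ^+ 2 + w ^+ 2)%:E)%E]].

Definition omega2 P h tau : \bar R := (omega P h tau ^+ 2)%E.

Definition OPT P h k : set ('I_k -> 'rV[R]_d) :=
  [set theta | forall tau : 'I_k -> 'rV[R]_d,
    (risk P theta (omega2 P h \o theta) <= risk P tau (omega2 P h \o tau))%E].

End measures.
Arguments OPT {R d} P h k _.

(* Main.v *)
From HB Require Import structures.
From mathcomp Require Import all_boot all_order all_algebra.
From mathcomp Require Import all_classical all_reals all_analysis.
From mathcomp Require Import ring lra measurable_realfun.
Require Import Defs.
Import Order.TTheory GRing.Theory Num.Theory.
Import numFieldNormedType.Exports.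
Local Open Scope classical_set_scope.
Local Open Scope ring_scope.
Set Implicit Arguments.
Unset Strict Implicit.
Unset Printing Implicit Defensive.

(** Write [Q] for the set of probability measures [mu] with [h mu <= P], [m] for the
    mean and [v] for the variance.  The squared DTM at [x] is the minimum over [Q] of
    [E_mu |u - x|^2 = |x - m(mu)|^2 + v(mu)], attained exactly by the local measures
    at [x].  Hence [omega^2(m(mu)) <= v(mu)], with equality for [mu] local at [x].
    The heart of the matter is a converse: if [d^2(x) <= |x - tau|^2 + w^2] for all
    [x], then some local measure, possibly at infinity, has mean [tau] and variance at
    most [w^2].  To see it, let [mu_n] minimize [n |m(mu) - tau|^2 + E_mu |u - tau|^2]
    over the compact convex set [Q].  The first-order condition says that [mu_n]
    is local at [x_n = tau - n (m(mu_n) - tau)], so the bound on [d^2(x_n)] yields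
    [E_{mu_n} |u - tau|^2 + 2 n |m(mu_n) - tau|^2 <= w^2]: the means tend to [tau], and
    a limit of the [mu_n] is local at a limit of the [x_n] in the completed space.
    Two local measures at the same point at infinity with the same mean coincide (no
    mass on the boundary hyperplane, or affinely independent atoms there), so
    [omega^2(m(mu)) = v(mu)] at infinity too.  The two minimization problems
    therefore have the same candidate functions, up to centres of infinite weight. *)

(** * Ultralimits and compactness of sub-measures *)

Section ultrafilter_limits.
Context {R : realType} {U : set_system nat}.
Hypothesis UU : UltraFilter U.

(** The image of [U] under [a] is an ultrafilter on the compact interval [[-C, C]], hence converges.
    A single ultrafilter serves all sequences at once, so no subsequence is ever extracted. *)
Lemma ultra_bounded_cvg (a : nat -> R) (C : R) :
  (\forall n \near U, `|a n| <= C) -> exists l : R, a n @[n --> U] --> l.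
Proof.
move=> aC.
have := @segment_compact R (- C) C; rewrite compact_ultra.
have UI : UltraFilter (a @ U).
  split; first exact: fmap_proper_filter.
  move=> G PG sG; apply/seteqP; split => A; last exact: sG.
  move=> GA; have [//|UC] := in_ultra_setVsetC (a @^-1` A) UU.
  have /sG GC : (a @ U) (~` A) by [].
  by have := filterI GA GC; rewrite setICr => G0; case: (@filter_not_empty _ G PG (G0 _)).
move=> /(_ (a @ U) UI) []; first by apply: filterS aC => n; rewrite /= in_itv/= ler_norml.
by move=> l [_ al]; exists l.
Qed.
End ultrafilter_limits.

Section dominated_content.
Context dd {T : measurableType dd} {R : realType}.
Variables (P : probability T R) (F : set T -> R) (C : R).
Hypothesis F_ge0 : forall A, measurable A -> 0 <= F A.
Hypothesis F_le : forall A, measurable A -> F A <= C * fine (P A).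
Hypothesis F_add : forall A B, measurable A -> measurable B -> A `&` B = set0 ->
  F (A `|` B) = F A + F B.
Hypothesis FT : F setT = 1.

(** Countable additivity follows from domination: for disjoint [A i], the defect after [n] terms is
    [F] of the tail of the union, at most [C] times its [P]-mass, which tends to 0. *)
Lemma dominated_content_probability : exists mu : probability T R,
  forall A, measurable A -> mu A = (F A)%:E.
Proof.
(* Nothing is known of [F] on nonmeasurable sets; the value 0 there makes [G] nonnegative
   everywhere. *)
pose G A : \bar R := if `[< measurable A >] then (F A)%:E else 0%E.
have GE A : measurable A -> G A = (F A)%:E by move=> mA; rewrite /G asboolT.
have F0 : F set0 = 0.
  have := @F_add set0 set0 measurable0 measurable0 (setI0 _).
  by rewrite setU0 => /eqP; rewrite -subr_eq0 opprD addNKr oppr_eq0 => /eqP.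
have G0 : G set0 = 0%E by rewrite GE// F0.
have Gge0 A : (0 <= G A)%E.
  by rewrite /G; case: asboolP => // mA; rewrite lee_fin F_ge0.
have Gs : semi_sigma_additive G.
  move=> A mA tA mU; rewrite GE//.
  have mUn n : measurable (\big[setU/set0]_(i < n) A i) by exact: bigsetU_measurable.
  have Fsum n : F (\big[setU/set0]_(i < n) A i) = \sum_(i < n) F (A i).
    elim: n => [|n IH]; first by rewrite !big_ord0.
    rewrite !big_ord_recr/= F_add ?IH; [by []|exact: mUn|exact: mA|].
    apply/seteqP; split => // x [].
    rewrite -bigcup_mkord => -[i /= ilt Aix] Anx.
    have /trivIsetP /(_ i n I I) := tA; rewrite ltn_eqF// => /(_ isT) AA;
      have : (A i `&` A n) x by []; by rewrite AA.
  rewrite [X in X @ _ --> _](_ : _ = (fun n => (\sum_(i < n) F (A i))%:E)); last first.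
    apply/funext => n; rewrite big_mkord -sumEFin.
    by apply: eq_bigr => i _; rewrite GE.
  apply/fine_cvgP; split; first by near=> n.
  have Pcv : (fine \o (fun n => \sum_(0 <= i < n) P (A i))%E) n @[n --> \oo] -->
      fine (P (\bigcup_n A n)).
    apply: fine_cvg; rewrite fineK ?fin_num_measure//.
    exact: measure_semi_sigma_additive.
  apply/cvgrPdist_le => e e0.
  have e1 : 0 < e / (`|C| + 1) by rewrite divr_gt0// ltr_wpDl.
  move/cvgrPdist_le : Pcv => /(_ _ e1); apply: filterS => n /=.
  pose D := (\bigcup_n A n) `\` \big[setU/set0]_(i < n) A i.
  have sub : \big[setU/set0]_(i < n) A i `<=` \bigcup_n A n.
    by rewrite -bigcup_mkord => x [i _ Aix]; exists i.
  have mD : measurable D by exact: measurableD.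
  have DU : \bigcup_n A n = \big[setU/set0]_(i < n) A i `|` D.
    by rewrite /D setDUK.
  have DI : \big[setU/set0]_(i < n) A i `&` D = set0 by rewrite /D setDIK.
  have -> : F (\bigcup_n A n) - \sum_(i < n) F (A i) = F D.
    by rewrite {1}DU F_add// Fsum addrAC subrr add0r.
  have -> : fine (P (\bigcup_n A n)) - fine (\sum_(0 <= i < n) P (A i))%E = fine (P D).
    rewrite {1}DU measureU// big_mkord -(@measure_bigsetU _ _ _ P)// fineD ?fin_num_measure//.
    by rewrite addrAC subrr add0r.
  have PD0 : 0 <= fine (P D) by rewrite fine_ge0.
  rewrite (ger0_norm PD0) (ger0_norm (F_ge0 mD)) => PDe.
  apply: (le_trans (F_le mD)).
  apply: (@le_trans _ _ ((`|C| + 1) * fine (P D))).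
    by rewrite ler_wpM2r// ler_wpDr// ler_norm.
  by rewrite mulrC -ler_pdivlMr// ltr_wpDl.
have GT : G setT = 1%E by rewrite GE// FT.
pose m1 := isMeasure.Build _ _ _ G G0 Gge0 Gs.
pose mM : measure T R := HB.pack G m1.
pose m2 := Measure_isProbability.Build _ T R mM GT.
pose mP : probability T R := HB.pack G m1 m2.
by exists mP => A mA; exact: GE.
Unshelve. all: by end_near. Qed.
End dominated_content.

(** * Expectations of functions bounded on a set of full measure *)

Section bounded_functions.
Context dd (T : measurableType dd) (R : realType) (B : set T).
Implicit Types (g : T -> R) (mu : probability T R).

(** Boundedness is asked on [B] only: coordinates and squared distances are unbounded on the whole
    space, but bounded on a ball carrying [P]. *)
Definition bfun g :=
  measurable_fun setT g /\ exists C : R, forall x, B x -> `|g x| <= C.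

Lemma bfun_cst c : bfun (fun=> c).
Proof. by split; [exact: measurable_cst|exists `|c|]. Qed.

Lemma bfunD g1 g2 : bfun g1 -> bfun g2 -> bfun (fun x => g1 x + g2 x).
Proof.
move=> [m1 [C1 b1]] [m2 [C2 b2]]; split; first exact: measurable_funD.
by exists (C1 + C2) => x Bx; rewrite (le_trans (ler_normD _ _))// lerD ?b1 ?b2.
Qed.

Lemma bfunM g1 g2 : bfun g1 -> bfun g2 -> bfun (fun x => g1 x * g2 x).
Proof.
move=> [m1 [C1 b1]] [m2 [C2 b2]]; split; first exact: measurable_funM.
by exists (C1 * C2) => x Bx; rewrite normrM ler_pM ?b1 ?b2.
Qed.

Lemma bfunZ c g : bfun g -> bfun (fun x => c * g x).
Proof. by apply: bfunM; exact: bfun_cst. Qed.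

Lemma bfunN g : bfun g -> bfun (fun x => - g x).
Proof.
move=> /(bfunZ (-1)); congr bfun.
by apply/funext => x; rewrite mulN1r.
Qed.

Lemma bfunB g1 g2 : bfun g1 -> bfun g2 -> bfun (fun x => g1 x - g2 x).
Proof. by move=> b1 /bfunN; exact: bfunD. Qed.

Lemma bfun_sum (I : Type) (s : seq I) (F : I -> T -> R) :
  (forall i, bfun (F i)) -> bfun (fun x => \sum_(i <- s) F i x).
Proof.
move=> bF; elim: s => [|i s IH].
  by under eq_fun do rewrite big_nil; exact: bfun_cst.
by under eq_fun do rewrite big_cons; exact: bfunD.
Qed.

Lemma bfun_max g1 g2 : bfun g1 -> bfun g2 -> bfun (fun x => Num.max (g1 x) (g2 x)).
Proof.
move=> [m1 [C1 b1]] [m2 [C2 b2]]; split; first exact: measurable_maxr.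
exists (Num.max C1 C2) => x Bx.
by rewrite le_max; case: (leP (g1 x) (g2 x)); rewrite ?b1 ?b2 ?orbT.
Qed.

Lemma bfun_indic A : measurable A -> bfun (\1_A).
Proof.
move=> mA; split; first exact: measurable_indic.
by exists 1 => x _; rewrite indicE; case: (x \in A); rewrite ?normr1 ?normr0.
Qed.

Hypothesis mB : measurable B.

Lemma bfun_integrable mu g : mu (~` B) = 0%E -> bfun g ->
  mu.-integrable setT (EFin \o g).
Proof.
move=> mu0 [mg [C gC]].
rewrite (negligible_integrable (N := ~` B)) ?setTD ?setCK//; last first.
- by apply/measurable_EFinP.
- exact: measurableC.
apply: measurable_bounded_integrable => //.
- by rewrite (le_lt_trans (probability_le1 mu mB)) ?ltry.
- exact: measurable_funTS.
- exists C; split; first exact: num_real.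
  by move=> M CM x Bx; apply: le_trans (gC _ Bx) (ltW CM).
Qed.

Lemma expect_restrict mu g : mu (~` B) = 0%E -> bfun g ->
  \int[mu]_x g x = \int[mu]_(x in B) g x.
Proof.
move=> mu0 bg; have [mg _] := bg.
rewrite /Rintegral (negligible_integral (N := ~` B)) ?setTD ?setCK//.
- exact: measurableC.
- exact: (bfun_integrable mu0 bg).
Qed.

Lemma expectD mu g1 g2 : mu (~` B) = 0%E -> bfun g1 -> bfun g2 ->
  \int[mu]_x (g1 x + g2 x) = \int[mu]_x g1 x + \int[mu]_x g2 x.
Proof. by move=> mu0 b1 b2; rewrite RintegralD//; exact: bfun_integrable. Qed.

Lemma expectZ mu c g : mu (~` B) = 0%E -> bfun g ->
  \int[mu]_x (c * g x) = c * \int[mu]_x g x.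
Proof. by move=> mu0 bg; rewrite RintegralZl//; exact: bfun_integrable. Qed.

Lemma expectN mu g : mu (~` B) = 0%E -> bfun g ->
  \int[mu]_x (- g x) = - \int[mu]_x g x.
Proof.
move=> mu0 bg; rewrite -mulN1r -expectZ//.
by apply: eq_Rintegral => x _; rewrite mulN1r.
Qed.

Lemma expectB mu g1 g2 : mu (~` B) = 0%E -> bfun g1 -> bfun g2 ->
  \int[mu]_x (g1 x - g2 x) = \int[mu]_x g1 x - \int[mu]_x g2 x.
Proof. by move=> mu0 b1 b2; rewrite expectD ?expectN//; exact: bfunN. Qed.

Lemma expect_cst mu c : \int[mu]_x c = c.
Proof.
rewrite Rintegral_cst//; transitivity (c * fine (mu setT)); first by [].
by rewrite probability_setT mulr1.
Qed.

Lemma expect_sum mu (I : Type) (s : seq I) (F : I -> T -> R) :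
  mu (~` B) = 0%E -> (forall i, bfun (F i)) ->
  \int[mu]_x (\sum_(i <- s) F i x) = \sum_(i <- s) \int[mu]_x F i x.
Proof.
move=> mu0 bF; elim: s => [|i s IH].
  rewrite big_nil; under eq_Rintegral do rewrite big_nil.
  by rewrite expect_cst.
rewrite big_cons -IH -expectD//; last exact: bfun_sum.
by apply: eq_Rintegral => x _; rewrite big_cons.
Qed.

Lemma expect_le mu g1 g2 : mu (~` B) = 0%E -> bfun g1 -> bfun g2 ->
  (forall x, B x -> g1 x <= g2 x) -> \int[mu]_x g1 x <= \int[mu]_x g2 x.
Proof.
move=> mu0 b1 b2 g12; rewrite !expect_restrict//; apply: le_Rintegral => //.
- exact: integrableS (bfun_integrable mu0 b1).
- exact: integrableS (bfun_integrable mu0 b2).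
Qed.

Lemma expect_ge0 mu g : mu (~` B) = 0%E -> bfun g ->
  (forall x, B x -> 0 <= g x) -> 0 <= \int[mu]_x g x.
Proof.
move=> mu0 bg g0; rewrite -[leLHS](expect_cst mu); apply: expect_le => //.
exact: bfun_cst.
Qed.

Lemma expect_indic mu A : measurable A -> \int[mu]_x \1_A x = fine (mu A).
Proof. by move=> mA; rewrite /Rintegral integral_indic// setIT. Qed.

Lemma expect_EFin mu g : mu (~` B) = 0%E -> bfun g ->
  (\int[mu]_x (g x)%:E)%E = (\int[mu]_x g x)%:E.
Proof.
move=> mu0 bg; rewrite fineK//; apply: integrable_fin_num => //.
exact: bfun_integrable.
Qed.

Lemma eq_expect mu1 mu2 g : (forall A, measurable A -> mu1 A = mu2 A) ->
  \int[mu1]_x g x = \int[mu2]_x g x.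
Proof.
by move=> e; rewrite /Rintegral (eq_measure_integral mu2)// => A mA _; exact: e.
Qed.

Lemma expect_comb mu mu1 mu2 (a b : R) g : 0 <= a -> 0 <= b ->
  mu (~` B) = 0%E -> mu1 (~` B) = 0%E -> mu2 (~` B) = 0%E ->
  (forall A, measurable A -> mu A = (a%:E * mu1 A + b%:E * mu2 A)%E) ->
  bfun g ->
  \int[mu]_x g x = a * \int[mu1]_x g x + b * \int[mu2]_x g x.
Proof.
move=> a0 b0 z z1 z2 muE bg; have [mg _] := bg.
(* For nonnegative functions the identity is additivity in the measure; the general case applies it
   to the positive and negative parts, whose integrals are finite. *)
have pos (f : T -> \bar R) : (forall x, 0 <= f x)%E -> measurable_fun setT f ->
    (\int[mu]_x f x = a%:E * \int[mu1]_x f x + b%:E * \int[mu2]_x f x)%E.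
  move=> f0 mf.
  pose m := measure_add (mscale (NngNum a0) mu1) (mscale (NngNum b0) mu2).
  have muE' A : measurable A -> A `<=` setT -> mu A = m A.
    by move=> mA _; rewrite muE// /m measure_addE.
  rewrite (eq_measure_integral m muE').
  by rewrite ge0_integral_measure_add// !ge0_integral_mscale.
have mE : measurable_fun setT (EFin \o g) by exact/measurable_EFinP.
have posp := pos _ (funepos_ge0 (EFin \o g)) (measurable_funepos mE).
have posn := pos _ (funeneg_ge0 (EFin \o g)) (measurable_funeneg mE).
have E (nu : probability T R) : (\int[nu]_x (g x)%:E =
    \int[nu]_x ((EFin \o g)^\+ x) - \int[nu]_x ((EFin \o g)^\- x))%E.
  by rewrite integralE.
rewrite /Rintegral (E mu) (E mu1) (E mu2) posp posn {posp posn}.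
have i1 := bfun_integrable z1 bg; have i2 := bfun_integrable z2 bg.
have := integrable_fin_num measurableT (integrable_funepos measurableT i1).
have := integrable_fin_num measurableT (integrable_funeneg measurableT i1).
have := integrable_fin_num measurableT (integrable_funepos measurableT i2).
have := integrable_fin_num measurableT (integrable_funeneg measurableT i2).
case: (\int[mu1]_x ((EFin \o g)^\+ x))%E => [p1| |]//.
case: (\int[mu1]_x ((EFin \o g)^\- x))%E => [q1| |]//.
case: (\int[mu2]_x ((EFin \o g)^\+ x))%E => [p2| |]//.
case: (\int[mu2]_x ((EFin \o g)^\- x))%E => [q2| |]// _ _ _ _ /=.
by ring.
Qed.

Lemma expect_eq0 mu g (A : set T) : mu (~` B) = 0%E -> bfun g ->
  (forall x, 0 <= g x) -> measurable A -> (forall x, A x <-> 0 < g x) ->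
  \int[mu]_x g x = 0 <-> mu A = 0%E.
Proof.
move=> mu0 bg g0 mA Ag; have [mg _] := bg.
have mE : measurable_fun setT (EFin \o g) by exact/measurable_EFinP.
have AE : A = [set x | 0 < g x] by apply/seteqP; split => x /Ag.
split.
- move=> g1; have : (\int[mu]_x `|(EFin \o g) x| = 0)%E.
    under eq_integral do rewrite /= ger0_norm//.
    by rewrite expect_EFin// g1.
  move/(ae_eq_integral_abs mu measurableT mE) => [N [mN N0 AN]].
  apply/eqP; rewrite eq_le measure_ge0 andbT -N0 le_measure// ?inE//.
  apply: subset_trans AN => x /Ag gx /= /(_ I) /eqP.
  by rewrite eqe gt_eqF.
- move=> A0; rewrite /Rintegral (negligible_integral (N := A))//; last first.
    exact: bfun_integrable.
  rewrite integral0_eq// => x [_ nAx].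
  have : ~ 0 < g x by move/Ag.
  by move/negP; rewrite -leNgt => gx; congr EFin; apply/le_anti; rewrite gx g0.
Qed.

End bounded_functions.

(** * Compactness and convexity of the normalized sub-measures of mass [h] *)

Section subprobabilities.
Context dd (T : measurableType dd) (R : realType).
Variables (P : probability T R) (h : R) (B : set T).
Hypotheses (mB : measurable B) (PB : P (~` B) = 0%E) (h0 : 0 < h).
Implicit Types (g psi : T -> R) (mu nu : probability T R).

Lemma fineP mu A : measurable A -> (fine (mu A))%:E = mu A.
Proof. by move=> mA; rewrite fineK// fin_num_measure. Qed.

Definition subprob mu := forall A, measurable A -> h * fine (mu A) <= fine (P A).

Lemma subprob_outside mu : subprob mu -> mu (~` B) = 0%E.
Proof.
move=> smu; have mCB := measurableC mB.
have := smu _ mCB; rewrite PB /= pmulr_rle0// => m0.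
by rewrite -fineP//; congr EFin; apply/le_anti; rewrite m0 fine_ge0.
Qed.

Section compactness.
Context (U : set_system nat).
Hypothesis UU : UltraFilter U.

(* A [0,1]-valued [g] is [(1_{g > 1/2} + g') / 2] with [g'] again [0,1]-valued, so
   each such step halves the error. *)
Lemma expect_setwise_cvg (mu_ : nat -> probability T R) mu :
  (forall n, mu_ n (~` B) = 0%E) -> mu (~` B) = 0%E ->
  (forall A, measurable A -> fine (mu_ n A) @[n --> U] --> fine (mu A)) ->
  forall g, bfun B g -> \int[mu_ n]_x g x @[n --> U] --> \int[mu]_x g x.
Proof.
move=> z_ z cvg_mu.
have half N : forall g, measurable_fun setT g -> (forall x, B x -> 0 <= g x <= 1) ->
    forall e, 0 < e ->
    \forall n \near U, `|\int[mu]_x g x - \int[mu_ n]_x g x| <= 2^-1 ^+ N + e.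
  elim: N => [|N IH] g mg g01 e e0.
    apply: nearW => n; rewrite expr0.
    have bg : bfun B g.
      by split=> //; exists 1 => x /g01/andP[g0 g1]; rewrite ger0_norm.
    have Eg1 nu : nu (~` B) = 0%E -> 0 <= \int[nu]_x g x <= 1.
      move=> z1; rewrite (expect_ge0 mB)//=; last by move=> x /g01/andP[].
      rewrite -[leRHS](expect_cst nu) (expect_le mB)//; first exact: bfun_cst.
      by move=> x /g01/andP[].
    have /andP[? ?] := Eg1 _ z; have /andP[? ?] := Eg1 _ (z_ n).
    by rewrite ler_norml; apply/andP; split; lra.
  pose A := [set x | 2^-1 < g x].
  have mA : measurable A.
    by rewrite -[A]setTI; apply: measurable_fun_ltr => //; exact: measurable_cst.
  have mI : measurable_fun setT (\1_A : T -> R) by exact: measurable_indic.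
  pose g' x := 2 * g x - \1_A x.
  have mg' : measurable_fun setT g'.
    by apply: measurable_funB => //; apply: measurable_funM => //; exact: measurable_cst.
  have g'01 x : B x -> 0 <= g' x <= 1.
    move=> /g01/andP[g0 g1]; rewrite /g' indicE.
    have [/set_mem Ax|Ax] := boolP (x \in A).
      by rewrite /A/= in Ax; apply/andP; split; rewrite /=; lra.
    have : ~ A x by move=> Ax'; move/negP: Ax; apply; rewrite inE.
    rewrite /A/= => /negP; rewrite -leNgt => gx.
    by apply/andP; split; rewrite /=; lra.
  have bg' : bfun B g'.
    by split=> //; exists 1 => x /g'01/andP[? ?]; rewrite ger0_norm.
  have bI : bfun B (\1_A : T -> R) by exact: bfun_indic.
  have Eg nu : nu (~` B) = 0%E ->
      \int[nu]_x g x = 2^-1 * fine (nu A) + 2^-1 * \int[nu]_x g' x.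
    move=> z1; rewrite -expect_indic// -!(expectZ mB)// -(expectD mB)//; last 2 first.
    - exact: bfunZ.
    - exact: bfunZ.
    by apply: eq_Rintegral => x _; rewrite /g'; field.
  have e2 : 0 < e / 2 by rewrite divr_gt0.
  have := IH _ mg' g'01 _ e2.
  have /cvgrPdist_le /(_ _ e2) := cvg_mu _ mA.
  apply: filterS2 => n; rewrite !Eg//.
  rewrite !ler_norml exprS => /andP[? ?] /andP[? ?].
  by apply/andP; split; lra.
move=> g [mg [C gC]].
(* The affine map carrying [[-C1, C1]] onto [[0, 1]] reduces to the previous case; adding 1 keeps
   [C1] positive. *)
pose C1 := `|C| + 1; have C10 : 0 < C1 by rewrite ltr_wpDl.
pose g1 x := (2 * C1)^-1 * g x + 2^-1.
have mg1 : measurable_fun setT g1.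
  by apply: measurable_funD => //; apply: measurable_funM => //; exact: measurable_cst.
have bg : bfun B g by split=> //; exists C.
have C2 : 0 < 2 * C1 by rewrite mulr_gt0.
have g101 x : B x -> 0 <= g1 x <= 1.
  move=> /gC; rewrite ler_norml => /andP[gl gu].
  have CC : C <= C1 by rewrite /C1 (le_trans (ler_norm _))// lerDl.
  have : - 2^-1 <= (2 * C1)^-1 * g x.
    by rewrite ler_pdivlMl//; lra.
  have : (2 * C1)^-1 * g x <= 2^-1.
    by rewrite ler_pdivrMl//; lra.
  by move=> ? ?; rewrite /g1; apply/andP; split; lra.
have E1 nu : nu (~` B) = 0%E ->
    \int[nu]_x g1 x = (2 * C1)^-1 * \int[nu]_x g x + 2^-1.
  move=> z1; rewrite (expectD mB)//; [|exact: bfunZ|exact: bfun_cst].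
  by rewrite (expectZ mB)// expect_cst.
apply/cvgrPdist_le => e e0.
(* The rescaling divides errors by [2 * C1]; the last factor splits the tolerance between [2^-N] and
   the error of [half]. *)
pose e' := e / (2 * C1) / 2.
have e'0 : 0 < e' by rewrite !divr_gt0.
have [N N'] : exists N : nat, 2^-1 ^+ N <= e'.
  have := @cvg_expr R 2^-1; rewrite ger0_norm// invf_lt1// ltr1n => /(_ isT).
  move/cvgrPdist_le => /(_ _ e'0) [N _ /(_ N (leqnn N))] /=.
  by rewrite sub0r normrN ger0_norm ?exprn_ge0//; exists N.
have := half N _ mg1 g101 _ e'0; apply: filterS => n; rewrite !E1//.
set a := \int[mu]_x g x; set b := \int[mu_ n]_x g x => ab.
have : `|(2 * C1)^-1 * (a - b)| <= e / (2 * C1).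
  have -> : (2 * C1)^-1 * (a - b) = (2 * C1)^-1 * a + 2^-1 - ((2 * C1)^-1 * b + 2^-1) by ring.
  by apply: (le_trans ab); rewrite /e' in N' *; lra.
rewrite normrM gtr0_norm ?invr_gt0// mulrC ler_pdivrMr//.
by rewrite divfK// gt_eqF.
Qed.

(* Weak compactness comes for free: a limit of set functions dominated by [P] is
   finitely additive, hence countably additive by domination. *)
Lemma subprob_compact (mu_ : nat -> probability T R) :
  (forall n, subprob (mu_ n)) ->
  exists mu, subprob mu /\
    forall g, bfun B g -> \int[mu_ n]_x g x @[n --> U] --> \int[mu]_x g x.
Proof.
move=> smu.
(* Measurability sits inside the existential so that choice yields a set function [F] defined on all
   sets. *)
have ex A : exists l : R, measurable A -> fine (mu_ n A) @[n --> U] --> l.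
  have [mA|nA] := pselect (measurable A); last by exists 0.
  have [l ul] : exists l : R, fine (mu_ n A) @[n --> U] --> l.
    apply: (@ultra_bounded_cvg _ _ UU _ 1); apply: nearW => n.
    rewrite ger0_norm ?fine_ge0// -[1%R]/(fine 1%:E) fine_le ?fin_num_measure//.
    exact: probability_le1.
  by exists l.
have [F FP] := choice ex.
have uni (x : nat -> R) (l l' : R) : x n @[n --> U] --> l -> x n @[n --> U] --> l' -> l = l'.
  move=> xl xl'; exact: (@cvg_unique _ (@norm_hausdorff _ R) (x @ U) _ l l' xl xl').
have FT : F setT = 1.
  apply: (uni _ _ _ (FP _ measurableT)).
  by under eq_fun do rewrite probability_setT; exact: cvg_cst.
have F_ge0 A : measurable A -> 0 <= F A.
  by move=> mA; apply: (cvgr_to_ge (FP _ mA)); apply: nearW => n; rewrite fine_ge0.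
have hF_le A : measurable A -> h * F A <= fine (P A).
  move=> mA; have hc : h * fine (mu_ n A) @[n --> U] --> h * F A.
    by apply: cvgM; [exact: cvg_cst|exact: FP].
  by apply: (cvgr_to_le hc); apply: nearW => n; exact: smu.
have [||mu muE] := @dominated_content_probability _ _ _ P F h^-1 F_ge0 _ _ FT.
- by move=> A mA; rewrite ler_pdivlMl// hF_le.
- move=> A A' mA mA' AA'; apply: (uni _ _ _ (FP _ (measurableU _ _ mA mA'))).
  under eq_fun do rewrite measureU// fineD ?fin_num_measure//.
  by apply: cvgD; exact: FP.
have smu' : subprob mu by move=> A mA; rewrite muE//= hF_le.
exists mu; split => //; apply: expect_setwise_cvg.
- by move=> n; exact: subprob_outside.
- exact: subprob_outside.
- by move=> A mA; rewrite muE//=; exact: FP.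
Qed.
End compactness.

(** Convexity of the class; it supplies the variations from which the first-order condition is
    derived. *)
Lemma subprob_mix mu1 mu2 t : subprob mu1 -> subprob mu2 -> 0 <= t <= 1 ->
  exists mu, subprob mu /\ forall g, bfun B g ->
    \int[mu]_x g x = (1 - t) * \int[mu1]_x g x + t * \int[mu2]_x g x.
Proof.
move=> s1 s2 /andP[t0 t1].
pose F A := (1 - t) * fine (mu1 A) + t * fine (mu2 A).
have t1' : 0 <= 1 - t by rewrite subr_ge0.
have hF_le A : measurable A -> h * F A <= fine (P A).
  move=> mA; have e1 := s1 _ mA; have e2 := s2 _ mA.
  have -> : h * F A = (1 - t) * (h * fine (mu1 A)) + t * (h * fine (mu2 A)).
    by rewrite /F; ring.
  have -> : fine (P A) = (1 - t) * fine (P A) + t * fine (P A) by ring.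
  by rewrite lerD// ler_wpM2l.
have [||||mu muE] := @dominated_content_probability _ _ _ P F h^-1.
- by move=> A mA; rewrite addr_ge0// mulr_ge0// fine_ge0.
- by move=> A mA; rewrite ler_pdivlMl// hF_le.
- by move=> A A' mA mA' AA'; rewrite /F !measureU// !fineD ?fin_num_measure//; ring.
- by rewrite /F !probability_setT/=; ring.
have smu : subprob mu by move=> A mA; rewrite muE//= hF_le.
exists mu; split => // g bg.
apply: (expect_comb mB) => //; try exact: subprob_outside.
by move=> A mA; rewrite muE// EFinD !EFinM !fineP.
Qed.

(** * The bathtub principle *)

Section threshold.
Variables (psi : T -> R) (c : R).
Hypothesis bpsi : bfun B psi.

(** Common form of locality in a ball or a half-space, both being sublevel sets of some [psi]:
    [h mu] fills [P] below the level [c], vanishes above it, and may be any part of [P] on the level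
    set. *)
Definition local_at mu := [/\ subprob mu,
  forall A, measurable A -> A `<=` [set x | psi x < c] -> h * fine (mu A) = fine (P A) &
  mu [set x | c < psi x] = 0%E].

Let mpsi : measurable_fun setT psi. Proof. by case: bpsi. Qed.

Let mlt : measurable [set x | psi x < c].
Proof.
by rewrite -[X in measurable X]setTI; apply: measurable_fun_ltr => //; exact: measurable_cst.
Qed.

Let mgt : measurable [set x | c < psi x].
Proof.
by rewrite -[X in measurable X]setTI; apply: measurable_fun_ltr => //; exact: measurable_cst.
Qed.

Let meq : measurable [set x | psi x = c].
Proof.
have -> : [set x | psi x = c] = ~` ([set x | psi x < c] `|` [set x | c < psi x]).
  apply/seteqP; split => x /=; first by move=> ->; rewrite ltxx => -[].
  by move=> /not_orP[/negP a /negP b]; apply/le_anti; rewrite !leNgt a b.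
by apply: measurableC; exact: measurableU.
Qed.

Let below x := Num.max (c - psi x) 0.
Let above x := Num.max (psi x - c) 0.

Let bbelow : bfun B below.
Proof. by apply: bfun_max; [apply: bfunB => //|]; exact: bfun_cst. Qed.

Let babove : bfun B above.
Proof. by apply: bfun_max; [apply: bfunB => //|]; exact: bfun_cst. Qed.

Section excess.
Hypothesis h1 : h < 1.

(** The mass of [P] left over by [h mu] is [1 - h > 0], so it can be normalized. *)
Lemma subprob_complement mu : subprob mu -> exists nu : probability T R,
  forall A, measurable A -> fine (P A) = h * fine (mu A) + (1 - h) * fine (nu A).
Proof.
move=> smu; have h1' : 0 < 1 - h by rewrite subr_gt0.
have [||||nu nuE] := @dominated_content_probability _ _ _ P
    (fun A => (1 - h)^-1 * (fine (P A) - h * fine (mu A))) (1 - h)^-1.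
- by move=> A mA; rewrite mulr_ge0 ?invr_ge0 ?(ltW h1')// subr_ge0 smu.
- move=> A mA; rewrite ler_wpM2l ?invr_ge0 ?(ltW h1')// gerBl.
  by rewrite mulr_ge0 ?fine_ge0// ltW.
- by move=> A A' mA mA' AA'; rewrite !measureU// !fineD ?fin_num_measure//; ring.
- by rewrite !probability_setT/= mulr1 mulVf// gt_eqF.
by exists nu => A mA; rewrite nuE//= mulVKf ?gt_eqF//; ring.
Qed.

Lemma complement_outside mu nu : subprob mu ->
  (forall A, measurable A -> fine (P A) = h * fine (mu A) + (1 - h) * fine (nu A)) ->
  nu (~` B) = 0%E.
Proof.
move=> smu PE; have mCB := measurableC mB.
have := PE _ mCB; rewrite PB (subprob_outside smu)/= mulr0 add0r => /esym/eqP.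
rewrite mulf_eq0 subr_eq0 gt_eqF//= => /eqP nu0.
by rewrite -fineP// nu0.
Qed.

(* The last two terms are nonnegative and vanish exactly when [mu] is local. *)
Lemma expect_excess mu nu : subprob mu ->
  (forall A, measurable A -> fine (P A) = h * fine (mu A) + (1 - h) * fine (nu A)) ->
  h * (\int[mu]_x psi x - c) =
    - (\int[P]_x below x) + h * \int[mu]_x above x + (1 - h) * \int[nu]_x below x.
Proof.
move=> smu PE; have h1' : 0 < 1 - h by rewrite subr_gt0.
have z := subprob_outside smu.
have z' := complement_outside smu PE.
rewrite (@expect_comb _ _ _ _ mB P mu nu h (1 - h))//; [|exact: ltW|exact: ltW|]; last first.
  by move=> A mA; rewrite -[P A]fineP// -[mu A]fineP// -[nu A]fineP// PE// EFinD !EFinM.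
have -> : \int[mu]_x psi x - c = \int[mu]_x above x - \int[mu]_x below x.
  rewrite -(expectB mB)// -[X in _ - X](expect_cst mu) -(expectB mB)//; last exact: bfun_cst.
  apply: eq_Rintegral => x _; rewrite /above /below.
  by case: (leP (psi x - c) 0); case: (leP (c - psi x) 0) => ? ?; lra.
by ring.
Qed.

(** [mu] gives no mass to [psi > c] iff [above] has zero mean; [h mu] exhausts [P] on [psi < c] iff
    the leftover [nu] gives it no mass, that is, iff [below] has zero mean. *)
Lemma local_expect0 mu nu : subprob mu ->
  (forall A, measurable A -> fine (P A) = h * fine (mu A) + (1 - h) * fine (nu A)) ->
  local_at mu <-> \int[mu]_x above x = 0 /\ \int[nu]_x below x = 0.
Proof.
move=> smu PE; have h1' : 0 < 1 - h by rewrite subr_gt0.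
have z := subprob_outside smu.
have z' := complement_outside smu PE.
have iA := @expect_eq0 _ _ _ _ mB mu above [set x | c < psi x] z babove.
have iB := @expect_eq0 _ _ _ _ mB nu below [set x | psi x < c] z' bbelow.
rewrite {}iA//; last 2 first.
- by move=> x; rewrite /above le_max lexx orbT.
- by move=> x; rewrite /above lt_max ltxx orbF subr_gt0.
rewrite {}iB//; last 2 first.
- by move=> x; rewrite /below le_max lexx orbT.
- by move=> x; rewrite /below lt_max ltxx orbF subr_gt0.
split=> [[_ /(_ _ mlt) + ->]|[mu0 nu0]].
  move=> /(_ (fun=> id)); rewrite (PE _ mlt) -[X in X = _]addr0.
  move=> /addrI/esym/eqP; rewrite mulf_eq0 gt_eqF//= => /eqP nu0.
  by split=> //; rewrite -fineP// nu0.
split=> // A mA Alt; rewrite PE//.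
have -> : nu A = 0%E.
  by apply/eqP; rewrite eq_le measure_ge0 andbT -nu0 le_measure// inE.
by rewrite mulr0 addr0.
Qed.

(** In [expect_excess] the term in [P] is common to all candidates, and the other two are
    nonnegative and vanish for [mu]. *)
Lemma local_minimizes mu mu' : local_at mu -> subprob mu' ->
  \int[mu]_x psi x <= \int[mu']_x psi x.
Proof.
move=> lmu smu'; have [smu _ _] := lmu.
have [nu PE] := subprob_complement smu; have [nu' PE'] := subprob_complement smu'.
have [a0 b0] := (local_expect0 smu PE).1 lmu.
rewrite -(lerD2r (- c)) -(ler_pM2l h0) (expect_excess smu PE) (expect_excess smu' PE').
rewrite a0 b0 !mulr0 !addr0 -addrA lerDl addr_ge0// mulr_ge0 ?subr_ge0 ?(ltW h0) ?(ltW h1)//.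
  by apply: (expect_ge0 mB) => //; [exact: subprob_outside|move=> x _; rewrite /above le_max lexx orbT].
apply: (expect_ge0 mB) => //; first exact: complement_outside PE'.
by move=> x _; rewrite /below le_max lexx orbT.
Qed.

(** Equality case of the bathtub principle: both nonnegative terms of [expect_excess] must vanish
    for [mu'] as well. *)
Lemma minimizer_local mu mu' : local_at mu -> subprob mu' ->
  \int[mu']_x psi x <= \int[mu]_x psi x -> local_at mu'.
Proof.
move=> lmu smu'; have [smu _ _] := lmu.
have [nu PE] := subprob_complement smu; have [nu' PE'] := subprob_complement smu'.
have [a0 b0] := (local_expect0 smu PE).1 lmu.
rewrite -(lerD2r (- c)) -(ler_pM2l h0) (expect_excess smu PE) (expect_excess smu' PE').
rewrite a0 b0 !mulr0 !addr0 -addrA gerDl => le0.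
apply/(local_expect0 smu' PE').
have ge1 : 0 <= \int[mu']_x above x.
  by apply: (expect_ge0 mB) => //; [exact: subprob_outside|move=> x _; rewrite /above le_max lexx orbT].
have ge2 : 0 <= \int[nu']_x below x.
  apply: (expect_ge0 mB) => //; first exact: complement_outside PE'.
  by move=> x _; rewrite /below le_max lexx orbT.
have h1' : 0 < 1 - h by rewrite subr_gt0.
have hge1 : 0 <= h * \int[mu']_x above x by rewrite mulr_ge0// ltW.
have hge2 : 0 <= (1 - h) * \int[nu']_x below x by rewrite mulr_ge0// ltW.
have e1 : h * \int[mu']_x above x = 0 by apply/le_anti; rewrite hge1 andbT; lra.
have e2 : (1 - h) * \int[nu']_x below x = 0 by apply/le_anti; rewrite hge2 andbT; lra.
by split; [move/eqP: e1|move/eqP: e2]; rewrite mulf_eq0 gt_eqF//= => /eqP.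
Qed.
End excess.

(** Take all of [P] below the level and the same fraction [lam] of it everywhere on the level set,
    with [lam] chosen to reach total mass [h]. *)
Lemma local_exists : fine (P [set x | psi x < c]) <= h ->
  h <= fine (P [set x | psi x <= c]) -> exists mu, local_at mu.
Proof.
set L := [set x | psi x < c]; set E := [set x | psi x = c] => PL.
have -> : [set x | psi x <= c] = L `|` E.
  apply/seteqP; split => x /=; rewrite /L /E/= le_eqVlt.
    by case/orP => [/eqP|]; [right|left].
  by case=> [->|->]; rewrite ?eqxx ?orbT.
have LE : L `&` E = set0.
  by apply/seteqP; split => // x [Lx Ex]; move: Lx; rewrite /L/= Ex ltxx.
rewrite measureU// fineD ?fin_num_measure// => PLE.
have PE0 : 0 <= fine (P E) by rewrite fine_ge0.
have PEh : h - fine (P L) <= fine (P E) by lra.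
have [lam [lam01 lamE]] : exists lam, 0 <= lam <= 1 /\
    lam * fine (P E) = h - fine (P L).
  (* If the level set is null, the two hypotheses force [P L = h], and [lam = 0] does. *)
  have [E0|Epos] := eqVneq (fine (P E)) 0.
    by exists 0; split; [rewrite lexx ler01|lra].
  have {}Epos : 0 < fine (P E) by rewrite lt_neqAle eq_sym Epos.
  exists ((h - fine (P L)) / fine (P E)); split; last by rewrite divfK// gt_eqF.
  by rewrite divr_ge0 ?subr_ge0//= ler_pdivrMr// mul1r.
have /andP[lam0 lam1] := lam01.
have mI A (D : set T) : measurable D -> measurable A -> measurable (A `&` D) by move=> *; exact: measurableI.
pose F A := h^-1 * (fine (P (A `&` L)) + lam * fine (P (A `&` E))).
have hF A : h * F A = fine (P (A `&` L)) + lam * fine (P (A `&` E)).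
  by rewrite /F mulVKf// gt_eqF.
have hF_le A : measurable A -> h * F A <= fine (P A).
  move=> mA; rewrite hF; apply: (@le_trans _ _ (fine (P (A `&` L)) + fine (P (A `&` E)))).
    by rewrite lerD2l ler_piMl// fine_ge0.
  rewrite -fineD ?fin_num_measure//; [|exact: mI|exact: mI].
  rewrite -measureU; [|exact: mI|exact: mI|]; last by rewrite setIACA LE setI0.
  have mU : measurable (A `&` L `|` A `&` E) by apply: measurableU; exact: mI.
  rewrite fine_le ?fin_num_measure// le_measure ?inE//.
  by move=> x [[]|[]].
have [||||mu muE] := @dominated_content_probability _ _ _ P F h^-1.
- move=> A mA; rewrite mulr_ge0 ?invr_ge0 ?(ltW h0)// addr_ge0 ?mulr_ge0 ?fine_ge0//.
- by move=> A mA; rewrite ler_pdivlMl// hF_le.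
- move=> A A' mA mA' AA'; rewrite /F !setIUl.
  have d D : (A `&` D) `&` (A' `&` D) = set0 by rewrite setIACA AA' set0I.
  have mAD D : measurable D -> measurable (A `&` D) by move=> mD; exact: mI.
  have mAD' D : measurable D -> measurable (A' `&` D) by move=> mD; exact: mI.
  rewrite !measureU ?d//; try exact: mAD; try exact: mAD'.
  rewrite !fineD ?fin_num_measure//; try exact: mAD; try exact: mAD'.
  by ring.
- by rewrite /F !setTI lamE addrC subrK mulVf// gt_eqF.
exists mu; split.
- by move=> A mA; rewrite muE//= hF_le.
- move=> A mA AL; rewrite muE//= hF.
  have -> : A `&` L = A by rewrite setIidl.
  have -> : A `&` E = set0.
    by apply/seteqP; split => // x [/AL Lx Ex]; rewrite -LE.
  by rewrite measure0/= mulr0 addr0.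
- rewrite muE// /F.
  have -> : [set x | c < psi x] `&` L = set0.
    by apply/seteqP; split => // x []/= a; rewrite /L/= => /(lt_trans a); rewrite ltxx.
  have -> : [set x | c < psi x] `&` E = set0.
    by apply/seteqP; split => // x [/= a Ex]; move: a; rewrite Ex ltxx.
  by rewrite measure0/= mulr0 addr0 mulr0.
Qed.
End threshold.
End subprobabilities.

(** * Euclidean geometry and moments *)

Section sublevel_measure.
Context dd (T : measurableType dd) (R : realType) (P : probability T R).

Lemma measurable_sublevel (psi : T -> R) c : measurable_fun setT psi ->
  [/\ measurable [set x | psi x <= c], measurable [set x | psi x < c],
      measurable [set x | c <= psi x] & measurable [set x | c < psi x]].
Proof.
move=> mpsi; have mc : measurable_fun setT (cst c : T -> R) by exact: measurable_cst.
by split; rewrite -[X in measurable X]setTI;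
  [exact: measurable_fun_ler|exact: measurable_fun_ltr
  |exact: measurable_fun_ler|exact: measurable_fun_ltr].
Qed.

(** Continuity from below along the levels [c - 1/(n+1)]. *)
Lemma open_sublevel_le (psi : T -> R) c b : measurable_fun setT psi ->
  (forall c', c' < c -> fine (P [set x | psi x <= c']) <= b) ->
  fine (P [set x | psi x < c]) <= b.
Proof.
move=> mpsi Pb.
pose A n := [set x | psi x <= c - n.+1%:R^-1].
have mA n : measurable (A n) by have [] := measurable_sublevel (c - n.+1%:R^-1) mpsi.
have -> : [set x | psi x < c] = \bigcup_n A n.
  apply/seteqP; split => x /=.
    move=> xc; have d0 : 0 < c - psi x by rewrite subr_gt0.
    have := near_infty_natSinv_lt (PosNum d0); move=> [n _ /(_ n (leqnn n))] /= nd.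
    exists n => //; rewrite /A/=.
    by set e := _^-1 in nd *; lra.
  move=> [n _]; rewrite /A/= => xn; apply: (le_lt_trans xn).
  by rewrite gtrBl invr_gt0.
have cv : fine (P (A n)) @[n --> \oo] --> fine (P (\bigcup_n A n)).
  apply: fine_cvg; rewrite fineP; last exact: bigcupT_measurable.
  apply: nondecreasing_cvg_mu => //; first exact: bigcupT_measurable.
  move=> m n mn; apply/subsetPset => x; rewrite /A/= => xm; apply: (le_trans xm).
  by rewrite lerD2l lerN2 lef_pV2 ?posrE// ler_nat.
apply: (cvgr_to_le cv); apply: nearW => n; apply: Pb.
by rewrite gtrBl invr_gt0.
Qed.

Lemma closed_sublevel_ge (psi : T -> R) c b : measurable_fun setT psi ->
  (forall c', c < c' -> b <= fine (P [set x | psi x <= c'])) ->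
  b <= fine (P [set x | psi x <= c]).
Proof.
move=> mpsi Pb.
have mN : measurable_fun setT (fun x => - psi x).
  by apply: measurableT_comp => //; exact: measurable_funN.
have PC (D : set T) : measurable D -> fine (P (~` D)) = 1 - fine (P D).
  by move=> mD; rewrite probability_setC// fineB ?fin_num_measure.
have [m1 _ _ _] := measurable_sublevel c mpsi.
have := @open_sublevel_le (fun x => - psi x) (- c) (1 - b) mN.
have -> : [set x | - psi x < - c] = ~` [set x | psi x <= c].
  by apply/seteqP; split => x /=; rewrite ltrN2 ltNge => /negP.
rewrite PC// => H.
suff : 1 - fine (P [set x | psi x <= c]) <= 1 - b by lra.
apply: H => c' cc'.
(* Here [c < - c'], and this level is the midpoint: the set [psi >= - c'] is disjoint from the
   sublevel set at the midpoint, which has mass at least [b]. *)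
have cc : c < (c - c') / 2 by lra.
have := Pb _ cc.
have [m2 _ _ _] := measurable_sublevel ((c - c') / 2) mpsi.
have [m3 _ _ _] := measurable_sublevel c' mN.
suff : fine (P [set x | - psi x <= c']) <= 1 - fine (P [set x | psi x <= (c - c') / 2]) by lra.
rewrite -PC//; apply: fine_le; rewrite ?fin_num_measure//; first exact: measurableC.
by apply: le_measure; rewrite ?inE//; [exact: measurableC|move=> x /= ? ?; lra].
Qed.
End sublevel_measure.

Section euclidean_geometry.
Context {R : realType} {d : nat}.
Implicit Types (u v x y : 'rV[R]_d).

Lemma dotC u v : dot u v = dot v u.
Proof. by apply: eq_bigr => j _; rewrite mulrC. Qed.

Lemma dotDl u v x : dot (u + v) x = dot u x + dot v x.
Proof. by rewrite -big_split; apply: eq_bigr => j _; rewrite /= mxE mulrDl. Qed.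

Lemma dotZl a u x : dot (a *: u) x = a * dot u x.
Proof. by rewrite /dot mulr_sumr; apply: eq_bigr => j _; rewrite mxE mulrA. Qed.

Lemma dotNl u x : dot (- u) x = - dot u x.
Proof. by rewrite -scaleN1r dotZl mulN1r. Qed.

Lemma dotBl u v x : dot (u - v) x = dot u x - dot v x.
Proof. by rewrite dotDl dotNl. Qed.

Lemma dotDr u v x : dot x (u + v) = dot x u + dot x v.
Proof. by rewrite dotC dotDl !(dotC x). Qed.

Lemma dotZr a u x : dot x (a *: u) = a * dot x u.
Proof. by rewrite dotC dotZl (dotC x). Qed.

Lemma dotNr u x : dot x (- u) = - dot x u.
Proof. by rewrite dotC dotNl (dotC x). Qed.

Lemma dotBr u v x : dot x (u - v) = dot x u - dot x v.
Proof. by rewrite dotDr dotNr. Qed.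

Lemma dot_ge0 u : 0 <= dot u u.
Proof. by apply: sumr_ge0 => j _; rewrite -expr2 sqr_ge0. Qed.

Lemma enorm_ge0 u : 0 <= enorm u. Proof. exact: sqrtr_ge0. Qed.

Lemma enorm_sqr u : enorm u ^+ 2 = dot u u.
Proof. by rewrite sqr_sqrtr// dot_ge0. Qed.

Lemma coord_le_enorm u j : `|u 0 j| <= enorm u.
Proof.
rewrite -sqrtr_sqr ler_wsqrtr// /dot (bigD1 j)//= -expr2 lerDl.
by apply: sumr_ge0 => i _; rewrite -expr2 sqr_ge0.
Qed.

Lemma dot_eq0 u : dot u u = 0 -> u = 0.
Proof.
move=> u0; apply/rowP => j; rewrite mxE; apply/eqP; rewrite -normr_eq0 eq_le normr_ge0 andbT.
by rewrite (le_trans (coord_le_enorm _ _))// /enorm u0 sqrtr0.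
Qed.

Lemma sqdist_shift u x y : enorm (u - x) ^+ 2 =
  enorm (u - y) ^+ 2 - 2 * dot (x - y) (u - y) + enorm (x - y) ^+ 2.
Proof.
rewrite !enorm_sqr !dotBl !dotBr (dotC x u) (dotC y u) (dotC x y); ring.
Qed.
End euclidean_geometry.

Section borel_functions.
Context {R : realType} {d : nat}.
Local Notation T := (borel_rV R d).

Lemma open_measurable_rV (A : set 'rV[R]_d) : open A -> measurable (A : set T).
Proof. by move=> oA; exact: sub_sigma_algebra. Qed.

Lemma continuous_measurable_rV (f : 'rV[R]_d -> R) :
  continuous f -> measurable_fun setT (f : T -> R).
Proof.
move=> /continuousP cf; apply: (measurability _ (RGenOpens.measurableE R)).
move=> _ [_ [a [b ->] <-]]; rewrite setTI; apply: open_measurable_rV.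
exact/cf/interval_open.
Qed.

Lemma measurable_coord j : measurable_fun setT (fun u : T => (u : 'rV[R]_d) 0 j).
Proof. by apply: continuous_measurable_rV; exact: coord_continuous. Qed.

Lemma measurable_dot v : measurable_fun setT (fun u : T => dot u v).
Proof.
apply: measurable_sum => j; apply: measurable_funM; first exact: measurable_coord.
exact: measurable_cst.
Qed.

Lemma measurable_sqdist x : measurable_fun setT (fun u : T => enorm ((u : 'rV[R]_d) - x) ^+ 2).
Proof.
under eq_fun do rewrite enorm_sqr.
apply: measurable_sum => j; under eq_fun do rewrite !mxE.
by apply: measurable_funM; apply: measurable_funD => //; exact: measurable_coord.
Qed.

Lemma measurable_dist x : measurable_fun setT (fun u : T => enorm ((u : 'rV[R]_d) - x)).
Proof.
have := measurable_sqdist x; under eq_fun do rewrite enorm_sqr.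
by apply: measurableT_comp; apply: continuous_measurable_fun; exact: sqrt_continuous.
Qed.

Lemma measurable_ecball x r : measurable (ecball x r : set T).
Proof.
case: r => [r| |].
- by have [] := measurable_sublevel r (measurable_dist x).
- rewrite (_ : ecball _ _ = setT)//; apply/seteqP; split => // u _.
  by rewrite /ecball/= leey.
- by rewrite (_ : ecball _ _ = set0)//; apply/seteqP; split.
Qed.

Lemma measurable_halfspace v c : measurable (halfspace v c : set T).
Proof.
case: c => [c| |].
- by have [] := measurable_sublevel c (measurable_dot v).
- by rewrite (_ : halfspace _ _ = set0)//; apply/seteqP; split.
- rewrite (_ : halfspace _ _ = setT)//; apply/seteqP; split => // u _.
  by rewrite /halfspace/= ltNye.
Qed.

Lemma measurable_chalfspace v c : measurable (chalfspace v c : set T).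
Proof.
case: c => [c| |].
- by have [] := measurable_sublevel c (measurable_dot v).
- by rewrite (_ : chalfspace _ _ = set0)//; apply/seteqP; split.
- rewrite (_ : chalfspace _ _ = setT)//; apply/seteqP; split => // u _.
  by rewrite /chalfspace/= leNye.
Qed.

Section moments.
Variable K : R.
Local Notation B := (ecball (0 : 'rV[R]_d) K%:E : set T).

Lemma bfun_coord j : bfun B (fun u => (u : 'rV[R]_d) 0 j).
Proof.
split; first exact: measurable_coord.
exists K => u; rewrite /ecball/= subr0 lee_fin; apply: le_trans.
exact: coord_le_enorm.
Qed.

Lemma bfun_dot v : bfun B (fun u => dot u v).
Proof.
by apply: bfun_sum => j; apply: bfunM; [exact: bfun_coord|exact: bfun_cst].
Qed.

Lemma bfun_sqdist x : bfun B (fun u => enorm ((u : 'rV[R]_d) - x) ^+ 2).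
Proof.
under eq_fun do rewrite enorm_sqr.
apply: bfun_sum => j; under eq_fun do rewrite !mxE.
by apply: bfunM; apply: bfunD; try exact: bfun_coord; exact: bfun_cst.
Qed.

Variable mu : probability T R.
Hypothesis muB : mu (~` B) = 0%E.
Let mB : measurable B := measurable_ecball 0 K%:E.

Lemma expect_dot v : \int[mu]_u dot u v = dot (mean mu) v.
Proof.
rewrite (expect_sum mB)//; last first.
  by move=> j; apply: bfunM; [exact: bfun_coord|exact: bfun_cst].
apply: eq_bigr => j _; rewrite mxE mulrC -(expectZ mB)//; last exact: bfun_coord.
by apply: eq_Rintegral => u _; rewrite mulrC.
Qed.

(** With [y = tau], subtracting [|x - tau|^2] leaves an expression affine in [x] whose slope is
    given by the mean. This links the minimization of squared distance at [x] to a first-order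
    condition at [tau]. *)
Lemma expect_sqdist_shift x y :
  \int[mu]_u (enorm ((u : 'rV[R]_d) - x) ^+ 2) =
  \int[mu]_u (enorm ((u : 'rV[R]_d) - y) ^+ 2)
    - 2 * dot (x - y) (mean mu - y) + enorm (x - y) ^+ 2.
Proof.
have bd : bfun B (fun u => dot (x - y) ((u : 'rV[R]_d) - y)).
  under eq_fun do rewrite dotBr (dotC (x - y)).
  by apply: bfunB; [exact: bfun_dot|exact: bfun_cst].
have -> : dot (x - y) (mean mu - y) = \int[mu]_u dot (x - y) ((u : 'rV[R]_d) - y).
  under eq_Rintegral do rewrite dotBr (dotC (x - y)).
  rewrite (expectB mB)//; [|exact: bfun_dot|exact: bfun_cst].
  by rewrite expect_dot expect_cst dotBr (dotC (mean mu)).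
have bs := bfun_sqdist y.
rewrite -(expectZ mB)// -(expectB mB)//; last exact: bfunZ.
rewrite -[X in _ + X](expect_cst mu) -(expectD mB)//; last 2 first.
- by apply: bfunB => //; exact: bfunZ.
- exact: bfun_cst.
by apply: eq_Rintegral => u _; exact: sqdist_shift.
Qed.

Lemma expect_sqdist_mean x :
  \int[mu]_u (enorm ((u : 'rV[R]_d) - x) ^+ 2) =
  \int[mu]_u (enorm ((u : 'rV[R]_d) - mean mu) ^+ 2) + enorm (x - mean mu) ^+ 2.
Proof.
rewrite (expect_sqdist_shift x (mean mu)) subrr.
have -> : dot (x - mean mu) 0 = 0 by rewrite -(scale0r 0) dotZr mul0r.
by rewrite mulr0 subr0.
Qed.

Lemma var_EFin : var mu = (\int[mu]_u (enorm ((u : 'rV[R]_d) - mean mu) ^+ 2))%:E.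
Proof. by rewrite /var (expect_EFin mB)//; exact: bfun_sqdist. Qed.
End moments.
End borel_functions.

(** * Local measures *)

Section thresholds.
Context {R : realType} {d : nat}.
Local Notation T := (borel_rV R d).
Variable P : probability T R.
Implicit Types (x v : 'rV[R]_d) (l s h : R).

Local Notation F x s := (fine (P (ecball x s%:E))).

Lemma ball_mass_le x s r : s <= r -> F x s <= F x r.
Proof.
move=> sr; rewrite fine_le ?fin_num_measure ?le_measure ?inE//;
  try exact: measurable_ecball.
by move=> u; rewrite /ecball/= => /le_trans; apply; rewrite lee_fin.
Qed.

Lemma delta_le l x s : 0 <= s -> l < F x s -> (delta P l x <= s%:E)%E.
Proof.
(* The radii in [delta] are positive while [s] may be 0, hence the test radius [s + e]. *)
move=> s0 lF; apply/lee_addgt0Pr => e e0; apply: ereal_inf_lbound.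
exists (s + e) => //=; split; first by rewrite ltr_wpDl.
rewrite -[P _]fineP; last exact: measurable_ecball.
by rewrite lte_fin (lt_le_trans lF)// ball_mass_le// lerDl ltW.
Qed.

Lemma delta_ge l x s : F x s <= l -> (s%:E <= delta P l x)%E.
Proof.
move=> Fl; apply: le_ereal_inf_tmp => _ [r [r0 lr] <-]; rewrite lee_fin leNgt.
apply/negP => rs; move: lr; rewrite -[P _]fineP; last exact: measurable_ecball.
by rewrite lte_fin ltNge (le_trans (ball_mass_le x (ltW rs)))// Fl.
Qed.

Lemma delta_ge0 l x : (0 <= delta P l x)%E.
Proof. by apply: le_ereal_inf_tmp => _ [r [r0 lr] <-]; rewrite lee_fin ltW. Qed.

(** The mass of closed balls is right-continuous in the radius, so some radius larger than [s] still
    has mass below [l]. *)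
Lemma delta_gt l x s : F x s < l -> (s%:E < delta P l x)%E.
Proof.
move=> Fl; have [c sc Fc] : exists2 c, s < c & F x c < l.
  apply: contrapT => H.
  suff : l <= F x s by rewrite leNgt Fl.
  apply: (closed_sublevel_ge (measurable_dist x)) => c sc; rewrite leNgt.
  by apply/negP => Fc; apply: H; exists c.
by rewrite (@lt_le_trans _ _ c%:E) ?lte_fin// delta_ge// ltW.
Qed.

Local Notation G v c := (fine (P (halfspace v c%:E))).

Lemma cut_le l v c : G v c <= l -> (cut P l v <= c%:E)%E.
Proof.
move=> Gl; apply: ge_ereal_sup => _ [r /= lr <-]; rewrite lee_fin leNgt.
apply/negP => cr; move: lr; rewrite -[P _]fineP; last exact: measurable_halfspace.
rewrite lte_fin ltNge (le_trans _ Gl)//.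
rewrite fine_le ?fin_num_measure ?le_measure ?inE//; try exact: measurable_halfspace.
by move=> u; rewrite /halfspace/= !lte_fin; exact: lt_trans.
Qed.

Lemma cut_ge l v c : l < G v c -> (c%:E <= cut P l v)%E.
Proof.
move=> lG; apply: ereal_sup_ubound; exists c => //=.
by rewrite -[P _]fineP ?lte_fin//; exact: measurable_halfspace.
Qed.

(** The sub-measure [Q] is determined by [mu] as [h mu], which removes the existential. *)
Lemma local_probsP h t mu : 0 < h ->
  local_probs P h t mu <-> [/\ subprob P h mu,
    forall A : set T, measurable A -> A `<=` local_region P h t ->
      h * fine (mu A) = fine (P A) &
    mu (~` local_cregion P h t) = 0%E].
Proof.
move=> h0; have mC : measurable (~` local_cregion P h t : set T).
  apply: measurableC; case: t => [x|v]; first exact: measurable_ecball.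
  exact: measurable_chalfspace.
split.
- move=> [Q [QP QT QA QC muE]].
  have Qfin A : measurable A -> Q A \is a fin_num.
    move=> mA; rewrite ge0_fin_numE// (le_lt_trans (QP _ mA))//.
    by rewrite -ge0_fin_numE// fin_num_measure.
  have E A : measurable A -> h * fine (mu A) = fine (Q A).
    move=> mA; rewrite muE// fineM//; last exact: Qfin.
    by rewrite /= mulVKf// gt_eqF.
  split.
  + by move=> A mA; rewrite E// fine_le ?Qfin ?fin_num_measure ?QP.
  + by move=> A mA AL; rewrite E// QA.
  + by rewrite muE// QC mule0.
- move=> [smu muL muC].
  pose Q : {measure set T -> \bar R} := mscale (NngNum (ltW h0)) mu.
  have E A : measurable A -> Q A = (h * fine (mu A))%:E.
    by move=> mA; rewrite EFinM fineP.
  exists Q; split.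
  + by move=> A mA; rewrite E// -[leRHS]fineP// lee_fin; exact: smu.
  + by rewrite E// probability_setT/= mulr1.
  + by move=> A mA AL; rewrite E// muL// fineP.
  + by rewrite E// muC/= mulr0.
  + by move=> A mA; rewrite E// -EFinM mulKf ?gt_eqF// fineP.
Qed.

(* The integrand minimized by the local measures at [t]: the half-space measure at
   [v_oo] minimizes [- <u, v>], the limit of [|u - s v|^2 / (2 s)] up to a constant. *)
Definition loss (t : extended_space R d) (u : T) : R :=
  match t with
  | inl x => enorm ((u : 'rV[R]_d) - x) ^+ 2
  | inr v => - dot u (sval v)
  end.

Variables (K h : R).
Local Notation B := (ecball (0 : 'rV[R]_d) K%:E : set T).
Hypotheses (PB : P (~` B) = 0%E) (h0 : 0 < h) (h1 : h <= 1).
Let mB : measurable B := measurable_ecball 0 K%:E.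

Lemma bfun_loss t : bfun B (loss t).
Proof.
case: t => [x|v]; first exact: bfun_sqdist.
by apply: bfunN; exact: bfun_dot.
Qed.

Lemma mass_full (A : set T) : measurable A -> B `<=` A -> fine (P A) = 1.
Proof.
move=> mA BA; apply/le_anti/andP; split.
  by rewrite -[leRHS]/(fine 1%:E) fine_le ?fin_num_measure ?probability_le1.
have : P B = 1%E.
  by have := probability_setC P (measurableC mB); rewrite setCK PB sube0.
move=> PB1; rewrite -[leLHS]/(fine 1%:E) -PB1 fine_le ?fin_num_measure ?le_measure ?inE//.
Qed.

(** A ball containing [B] has mass 1 > [h], so the radius is finite. Smaller radii have mass at most
    [h] and larger ones at least [h]; both bounds pass to the limit at [r]. *)
Lemma delta_threshold x : h < 1 -> exists r, [/\ 0 <= r, delta P h x = r%:E,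
  fine (P [set u : T | loss (inl x) u < r ^+ 2]) <= h &
  h <= fine (P [set u : T | loss (inl x) u <= r ^+ 2])].
Proof.
move=> h1'; have [_ [C HC]] := bfun_sqdist K x.
have C0 : 0 <= `|C| + 1 by rewrite addr_ge0.
have FC : F x (`|C| + 1) = 1.
  apply: mass_full; first exact: measurable_ecball.
  move=> u /HC uC; rewrite /ecball/= lee_fin.
  rewrite -(@ler_pXn2r _ 2)// ?nnegrE ?enorm_ge0//.
  apply: (le_trans (ler_norm _)); apply: (le_trans uC); apply: (le_trans (ler_norm _)).
  by rewrite sqrrD expr1n mulr1; have := sqr_ge0 (`|C|); have := normr_ge0 C; lra.
have := delta_ge0 h x; have : (delta P h x <= (`|C| + 1)%:E)%E.
  by apply: delta_le => //; rewrite FC.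
case E : (delta P h x) => [r| |]// _; rewrite lee_fin => r0.
exists r; split => //.
- have -> : [set u : T | loss (inl x) u < r ^+ 2] =
      [set u : T | enorm ((u : 'rV[R]_d) - x) < r].
    by apply/seteqP; split => u /=; rewrite ltr_pXn2r// nnegrE enorm_ge0.
  apply: open_sublevel_le; first exact: measurable_dist.
  move=> c cr; have [c0|c0] := leP 0 c.
    rewrite leNgt; apply/negP => hF; have := delta_le c0 hF.
    by rewrite E lee_fin leNgt cr.
  rewrite (_ : [set _ | _] = set0) ?measure0 ?ltW//.
  apply/seteqP; split => // u /= uc.
  have := le_lt_trans uc c0; rewrite ltNge => /negP; apply; exact: enorm_ge0.
- have -> : [set u : T | loss (inl x) u <= r ^+ 2] =
      [set u : T | enorm ((u : 'rV[R]_d) - x) <= r].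
    by apply/seteqP; split => u /=; rewrite ler_pXn2r// nnegrE enorm_ge0.
  apply: closed_sublevel_ge; first exact: measurable_dist.
  move=> c rc; rewrite leNgt; apply/negP => /ltW Fh.
  by have := delta_ge Fh; rewrite E lee_fin leNgt rc.
Qed.

Lemma cut_threshold v : h < 1 -> exists c, [/\ cut P h v = c%:E,
  fine (P [set u : T | - dot u v < - c]) <= h &
  h <= fine (P [set u : T | - dot u v <= - c])].
Proof.
move=> h1'; have [_ [C HC]] := bfun_dot K v.
have mN : measurable_fun setT (fun u : T => - dot u v).
  by have [] := bfunN (bfun_dot K v).
(* At level [- C - 1] the half-space contains [B], at level [C + 1] it misses [B]; so the cut is
   finite. *)
have GC1 : G v (- C - 1) = 1.
  apply: mass_full; first exact: measurable_halfspace.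
  by move=> u /HC; rewrite /halfspace/= lte_fin ler_norml => /andP[? ?]; lra.
have GC0 : G v (C + 1) = 0.
  suff : fine (P (~` halfspace v (C + 1)%:E)) = 1.
    rewrite probability_setC; last exact: measurable_halfspace.
    rewrite fineB ?fin_num_measure//; last exact: measurable_halfspace.
    by rewrite /=; lra.
  apply: mass_full; first by apply: measurableC; exact: measurable_halfspace.
  by move=> u /HC; rewrite /halfspace/= lte_fin ler_norml => /andP[? ?]; apply/negP; lra.
have := @cut_le h v (C + 1); rewrite GC0 => /(_ (ltW h0)).
have := @cut_ge h v (- C - 1); rewrite GC1 => /(_ h1').
case E : (cut P h v) => [c| |]// _ _.
exists c; split => //.
- apply: open_sublevel_le => // c' cc'.
  (* The midpoint of [c] and [- c'] lies above the cut, and its open half-space contains the closed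
     one at [- c']. *)
  have Gh : G v ((c - c') / 2) <= h.
    rewrite leNgt; apply/negP => /cut_ge; rewrite E lee_fin; lra.
  apply: le_trans Gh; rewrite fine_le ?fin_num_measure ?le_measure ?inE//;
    try exact: measurable_halfspace; try by have [] := measurable_sublevel c' mN.
  by move=> u /=; rewrite /halfspace/= lte_fin => ?; lra.
- apply: closed_sublevel_ge => // c' cc'.
  have Gh : h <= G v (- c').
    rewrite leNgt; apply/negP => /ltW /cut_le; rewrite E lee_fin; lra.
  apply: (le_trans Gh); rewrite fine_le ?fin_num_measure ?le_measure ?inE//;
    try exact: measurable_halfspace; try by have [] := measurable_sublevel c' mN.
  by move=> u /=; rewrite /halfspace/= lte_fin => ?; lra.
Qed.

Lemma local_probs_halfspace (v : {v : 'rV[R]_d | enorm v = 1}) c mu : cut P h (sval v) = c%:E ->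
  local_probs P h (inr v) mu <-> local_at P h (loss (inr v)) (- c) mu.
Proof.
move=> E; rewrite (local_probsP _ _ h0) /local_at /= E.
have -> : halfspace (sval v) c%:E = [set u | - dot u (sval v) < - c].
  by apply/seteqP; split => u; rewrite /halfspace/= lte_fin ltrN2.
have -> : ~` chalfspace (sval v) c%:E = [set u | - c < - dot u (sval v)]; last by [].
by apply/seteqP; split => u; rewrite /chalfspace/= lee_fin ltrN2 ltNge => /negP.
Qed.

Lemma local_probs_threshold t : h < 1 -> exists c,
  [/\ forall mu, local_probs P h t mu <-> local_at P h (loss t) c mu,
    fine (P [set u : T | loss t u < c]) <= h &
    h <= fine (P [set u : T | loss t u <= c])].
Proof.
move=> h1'; case: t => [x|v].
- have [r [r0 E lt_h le_h]] := delta_threshold x h1'.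
  exists (r ^+ 2); split => // mu; rewrite (local_probsP _ _ h0) /local_at /= E.
  have -> : eball x r%:E = [set u | enorm (u - x) ^+ 2 < r ^+ 2].
    by apply/seteqP; split => u; rewrite /eball/= lte_fin ltr_pXn2r// nnegrE enorm_ge0.
  have -> : ~` ecball x r%:E = [set u | r ^+ 2 < enorm (u - x) ^+ 2]; last by [].
  by apply/seteqP; split => u; rewrite /ecball/= lee_fin ltr_pXn2r ?nnegrE ?enorm_ge0//
    ltNge => /negP.
- have [c [E lt_h le_h]] := cut_threshold (sval v) h1'.
  by exists (- c); split => // mu; exact: local_probs_halfspace.
Qed.

(** Domination on [A] and on its complement, with equal total masses, forces equality. *)
Lemma subprob_full mu : h = 1 -> subprob P h mu ->
  forall A, measurable A -> mu A = P A.
Proof.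
move=> h1' smu A mA; have mAC := measurableC mA.
rewrite -[mu A]fineP// -[P A]fineP//; congr EFin.
have := smu _ mA; have := smu _ mAC; rewrite h1' !mul1r.
rewrite !probability_setC// !fineB ?fin_num_measure//= => ? ?.
by apply/le_anti/andP; split; lra.
Qed.

(** No set has mass above 1, so by the conventions on empty sets [delta] is infinite, the cut is
    minus infinity, and every local region is the whole space. *)
Lemma local_probs_full t mu : h = 1 -> local_probs P h t mu <-> subprob P h mu.
Proof.
move=> h1'; rewrite (local_probsP _ _ h0); split => [[]//|smu].
have E := subprob_full h1' smu.
split=> //; first by move=> A mA _; rewrite h1' mul1r E.
have Pgt (A : set T) : measurable A -> ~ (1%:E < P A)%E.
  by move=> mA /lt_geF; rewrite probability_le1.
case: t => [x|v] /=.
- rewrite /delta (_ : [set r : R | _] = set0); last first.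
    by apply/seteqP; split => // r [_]; rewrite h1' => /Pgt; apply; exact: measurable_ecball.
  rewrite image_set0 ereal_inf0 (_ : ecball _ _ = setT) ?setCT ?measure0//.
  by apply/seteqP; split => // u _; rewrite /ecball/= leey.
- rewrite /cut (_ : [set c : R | _] = set0); last first.
    by apply/seteqP; split => // r /=; rewrite h1' => /Pgt; apply; exact: measurable_halfspace.
  rewrite image_set0 ereal_sup0 (_ : chalfspace _ _ = setT) ?setCT ?measure0//.
  by apply/seteqP; split => // u _; rewrite /chalfspace/= leNye.
Qed.

Lemma local_probs_subprob t mu : local_probs P h t mu -> subprob P h mu.
Proof. by move=> /(local_probsP _ _ h0)[]. Qed.

Lemma local_probs_exists t : exists mu, local_probs P h t mu.
Proof.
have [h1'|h1'] := ltP h 1.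
  have [c [E Plt Ple]] := local_probs_threshold t h1'.
  have [mu lmu] := local_exists h0 (bfun_loss t) Plt Ple.
  by exists mu; apply/E.
have h1E : h = 1 by apply/le_anti; rewrite h1 h1'.
by exists P; apply/(local_probs_full _ _ h1E) => A mA; rewrite h1E mul1r.
Qed.

Lemma local_probs_minimizes t mu mu' : local_probs P h t mu -> subprob P h mu' ->
  \int[mu]_u loss t u <= \int[mu']_u loss t u.
Proof.
have [h1'|h1'] := ltP h 1.
  have [c [E _ _]] := local_probs_threshold t h1'.
  by move=> /E lmu smu'; exact: (local_minimizes mB PB h0 (bfun_loss t) h1' lmu).
have h1E : h = 1 by apply/le_anti; rewrite h1 h1'.
move=> /local_probs_subprob smu smu'; rewrite (@eq_expect _ _ _ mu mu')// => A mA.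
by rewrite !(subprob_full h1E).
Qed.

Lemma minimizer_local_probs t mu mu' : local_probs P h t mu -> subprob P h mu' ->
  \int[mu']_u loss t u <= \int[mu]_u loss t u -> local_probs P h t mu'.
Proof.
have [h1'|h1'] := ltP h 1.
  have [c [E _ _]] := local_probs_threshold t h1'.
  move=> /E lmu smu' le; apply/E.
  exact: (minimizer_local mB PB h0 (bfun_loss t) h1' lmu smu' le).
have h1E : h = 1 by apply/le_anti; rewrite h1 h1'.
by move=> _ smu' _; apply/(local_probs_full _ _ h1E).
Qed.
End thresholds.

(** * The DTM as a second moment of a local measure *)

Lemma layer_cake dd (T : measurableType dd) (R : realType) (P : probability T R)
    (g : T -> R) : measurable_fun setT g -> (forall x, 0 <= g x) ->
  (\int[P]_x (g x)%:E =
   \int[lebesgue_measure]_(r in `[0%R, +oo[) P [set x | (r < g x)%R])%E.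
Proof.
move=> mg g0.
pose X : {RV P >-> R} := HB.pack g (@isMeasurableFun.Build _ _ T R g mg).
have := @ge0_expectation_ccdf _ T R P X g0; rewrite expectation_def => ->.
apply: eq_integral => r _; rewrite /ccdf /distribution /pushforward/=.
by congr (P _); apply/seteqP; split => x /=; rewrite in_itv/= andbT.
Qed.

(** With this, the squared DTM reads as the expectation of [delta^2] at a level drawn uniformly from
    [[0, h]]. *)
Lemma uniform_probE (R : realType) (h : R) (h0 : 0 < h) (A : set R) : measurable A ->
  (uniform_prob h0 A = (h^-1)%:E * lebesgue_measure (A `&` `[0%R, h]))%E.
Proof.
move=> mA; have mE : measurable_fun setT (fun x : R => (\1_A x)%:E : \bar R).
  by apply/measurable_EFinP; exact: measurable_indic.
have := @integral_uniform R 0 h h0 (fun x => (\1_A x)%:E) mE.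
rewrite integral_indic// setIT => ->; last by move=> x; rewrite lee_fin.
by rewrite subr0 integral_indic.
Qed.

Section dtm.
Context {R : realType} {d : nat}.
Local Notation T := (borel_rV R d).
Variables (P : probability T R) (K h : R).
Local Notation B := (ecball (0 : 'rV[R]_d) K%:E : set T).
Hypotheses (PB : P (~` B) = 0%E) (h0 : 0 < h) (h1 : h <= 1).
Let mB : measurable B := measurable_ecball 0 K%:E.
Local Notation F x s := (fine (P (ecball x s%:E))).

(** For [s] below the local radius the ball lies where [h mu] and [P] agree; from that radius on it
    carries all of [mu]. *)
Lemma local_ball_mass x mu s : local_probs P h (inl x) mu -> 0 <= s ->
  h * fine (mu (ecball x s%:E)) = Num.min (F x s) h.
Proof.
move=> /(local_probsP _ _ _ h0)[/= smu muL muC] s0.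
have mE := measurable_ecball x s%:E.
have [sd|ds] := ltP s%:E (delta P h x).
  rewrite muL//; last first.
    by move=> u; rewrite /ecball /eball/= => us; rewrite (le_lt_trans us).
  rewrite min_l// leNgt; apply/negP => /(delta_le s0).
  by rewrite leNgt sd.
have -> : fine (mu (ecball x s%:E)) = 1.
  have : mu (~` ecball x s%:E) = 0%E.
    apply/eqP; rewrite eq_le measure_ge0 andbT -muC le_measure// ?inE//.
    - exact: measurableC.
    - by apply: measurableC; exact: measurable_ecball.
    - by move=> u; rewrite /ecball/= => /negP; rewrite -ltNge => su; apply/negP;
        rewrite -ltNge (le_lt_trans ds).
  rewrite probability_setC// => /eqP.
  rewrite -[mu _]fineP// -EFinB eqe subr_eq0 => /eqP <- //.
rewrite mulr1 min_r// leNgt; apply/negP => /delta_gt.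
by rewrite ltNge ds.
Qed.

(** Both sides are expectations of nonnegative variables with the same tails: at [r = s^2], the
    uniform level has [delta > s] with probability [1 - min(F x s, h) / h], which is the [mu]-mass
    outside the closed ball of radius [s]. *)
Lemma dtm2_local x mu : local_probs P h (inl x) mu ->
  dtm2 P h x = (\int[mu]_u (enorm ((u : 'rV[R]_d) - x) ^+ 2))%:E.
Proof.
move=> lmu; have smu := local_probs_subprob h0 lmu.
have muB := subprob_outside mB PB h0 smu.
have [_ [C HC]] := bfun_sqdist K x.
pose M := `|C| + 1; have M0 : 0 <= M by rewrite addr_ge0.
have FM : F x M = 1.
  apply: (mass_full PB); first exact: measurable_ecball.
  move=> u /HC uC; rewrite /ecball/= lee_fin.
  rewrite -(@ler_pXn2r _ 2)// ?nnegrE ?enorm_ge0//.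
  apply: (le_trans (ler_norm _)); apply: (le_trans uC); apply: (le_trans (ler_norm _)).
  by rewrite sqrrD expr1n mulr1; have := sqr_ge0 (`|C|); have := normr_ge0 C; lra.
(* Truncation at [M] makes [delta] real-valued at every level, and changes nothing for [l < 1]. *)
pose D l := fine (mine (delta P l x) M%:E).
have Dfin l : (D l)%:E = mine (delta P l x) M%:E.
  rewrite /D; have := delta_ge0 P l x.
  by case: (delta P l x) => [r| |]// _; rewrite -EFin_min.
have D0 l : 0 <= D l by rewrite -lee_fin Dfin le_min delta_ge0 lee_fin.
have DE l : l < 1 -> (D l)%:E = delta P l x.
  by move=> l1; rewrite Dfin min_l//; apply: delta_le => //; rewrite FM.
have Dmono : {homo D : l l' / l <= l'}.
  move=> l l' ll'; rewrite -lee_fin !Dfin.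
  suff dd : (delta P l x <= delta P l' x)%E.
    by rewrite le_min !ge_min dd/= lexx orbT.
  apply: ereal_inf_le_tmp => _ [r [r0 rl] <-]; exists r => //; split => //.
  by apply: le_lt_trans rl; rewrite lee_fin.
have mD : measurable_fun setT D by apply: nondecreasing_measurable.
pose X l := D l ^+ 2.
have mX : measurable_fun setT X by apply: measurable_funX.
have X0 l : 0 <= X l by rewrite sqr_ge0.
have mXE : measurable_fun setT (EFin \o X) by exact/measurable_EFinP.
have XE l : l < 1 -> (delta P l x ^+ 2 = (X l)%:E)%E.
  by move=> l1; rewrite -DE// EFin_expe.
have -> : dtm2 P h x = (\int[uniform_prob h0]_l (X l)%:E)%E.
  have XE0 l : (0 <= (EFin \o X) l)%E by rewrite lee_fin.
  rewrite (integral_uniform h0 mXE XE0) subr0.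
  rewrite /dtm2; congr (_ * _)%E.
  (* Dropping the endpoint [l = h] discards the one level where [delta] may be infinite, namely when
     [h = 1]. *)
  rewrite -!integral_itv_bndo_bndc.
  - apply: eq_integral => l; rewrite inE/= in_itv/= => /andP[_ lh].
    exact: XE (lt_le_trans lh h1).
  - apply: (eq_measurable_fun (EFin \o X)); last exact: measurable_funTS.
    move=> l; rewrite inE/= in_itv/= => /andP[_ lh].
    by have /esym := XE l (lt_le_trans lh h1).
  - exact: measurable_funTS.
rewrite -(expect_EFin mB muB (bfun_sqdist K x)).
rewrite (layer_cake (uniform_prob h0) mX X0) (layer_cake mu (measurable_sqdist x)); last first.
  by move=> u; rewrite sqr_ge0.
apply: eq_integral => r; rewrite inE/= in_itv/= andbT => r0.
pose s := Num.sqrt r; have s0 : 0 <= s by rewrite sqrtr_ge0.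
have sr : r = s ^+ 2 by rewrite sqr_sqrtr.
set q := F x s.
have q0 : 0 <= q by rewrite fine_ge0.
have mA : measurable [set l | r < X l].
  by have [] := measurable_sublevel r mX.
rewrite uniform_probE//.
have AE l : (r < X l) = (s < D l) by rewrite sr /X ltr_pXn2r// nnegrE.
have -> : lebesgue_measure ([set l | r < X l] `&` `[0, h]) =
    (h - Num.min q h)%:E.
  (* Levels below [q] have [delta <= s], levels above have [delta > s]; the set is thus sandwiched
     between []q, h[] and [[q, h]], of equal length. *)
  have itvE b b' : lebesgue_measure [set` Interval (BSide b q) (BSide b' h)] =
      (h - Num.min q h)%:E.
    by rewrite lebesgue_measure_itv/= lte_fin; case: ltP => [qh|hq]; rewrite ?subrr// EFinB.
  apply/eqP; rewrite eq_le; apply/andP; split.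
    rewrite -(itvE true false) le_measure ?inE//; first exact: measurableI.
    move=> l []/=; rewrite AE => sD; rewrite !in_itv/= => /andP[l0 lh].
    rewrite lh andbT leNgt; apply/negP => lq.
    have := delta_le s0 lq; rewrite leNgt => /negP; apply.
    by rewrite (@lt_le_trans _ _ (D l)%:E)// Dfin ge_min lexx.
  rewrite -(itvE false true) le_measure ?inE//; first exact: measurableI.
  move=> l /=; rewrite !in_itv/= => /andP[ql lh].
  split; last by rewrite (ltW (le_lt_trans q0 ql)) ltW.
  rewrite AE -lte_fin DE; first exact: delta_gt.
  exact: lt_le_trans lh h1.
have -> : [set u : T | r < enorm ((u : 'rV[R]_d) - x) ^+ 2] = ~` ecball x s%:E.
  apply/seteqP; split => u; rewrite /ecball/= lee_fin sr ltr_pXn2r ?nnegrE ?enorm_ge0// ltNge.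
    by move/negP.
  by move=> /negP.
have mE := measurable_ecball x s%:E.
rewrite probability_setC// -[mu _]fineP// -EFinB -EFinM; congr EFin.
by rewrite mulrBr mulVf ?gt_eqF// -(local_ball_mass lmu s0) mulKf// gt_eqF.
Qed.
End dtm.

(** * Attainment of the weights *)

Section coordinatewise_limits.
Context {R : realType} {d : nat} (U : set_system nat).
Hypothesis UU : UltraFilter U.
Implicit Types a b : nat -> 'rV[R]_d.

Lemma cvg_dot a b (a' b' : 'rV[R]_d) :
  (forall j, a n 0 j @[n --> U] --> a' 0 j) ->
  (forall j, b n 0 j @[n --> U] --> b' 0 j) ->
  dot (a n) (b n) @[n --> U] --> dot a' b'.
Proof.
move=> ca cb; apply: cvg_big => [|j _]; last by apply: cvgM; [exact: ca|exact: cb].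
by move=> x; exact: add_continuous.
Qed.

Lemma cvg_coordB a b (a' b' : 'rV[R]_d) :
  (forall j, a n 0 j @[n --> U] --> a' 0 j) ->
  (forall j, b n 0 j @[n --> U] --> b' 0 j) ->
  forall j, (a n - b n) 0 j @[n --> U] --> (a' - b') 0 j.
Proof.
move=> ca cb j; under eq_fun do rewrite mxE [X in _ + X]mxE.
by rewrite !mxE; apply: cvgB; [exact: ca|exact: cb].
Qed.

Lemma cvg_coord_cst (a' : 'rV[R]_d) j : (fun=> a' 0 j) @ U --> a' 0 j.
Proof. exact: cvg_cst. Qed.

Lemma ultra_bounded_coord_cvg a (C : R) :
  (\forall n \near U, enorm (a n) <= C) ->
  exists a' : 'rV[R]_d, forall j, a n 0 j @[n --> U] --> a' 0 j.
Proof.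
move=> aC; have ex j : exists l : R, a n 0 j @[n --> U] --> l.
  apply: (@ultra_bounded_cvg _ _ UU _ C); apply: filterS aC => n.
  exact/le_trans/coord_le_enorm.
have [l cl] := choice ex.
by exists (\row_j l j) => j; rewrite mxE; exact: cl.
Qed.
End coordinatewise_limits.

Lemma dot_line {R : realType} {d : nat} (a b : 'rV[R]_d) (t : R) :
  dot (a + t *: b) (a + t *: b) = dot a a + 2 * t * dot a b + t ^+ 2 * dot b b.
Proof. by rewrite dotDl !dotDr !dotZl !dotZr (dotC b a); ring. Qed.

Section weights.
Context {R : realType} {d : nat}.
Local Notation T := (borel_rV R d).
Variables (P : probability T R) (K h : R).
Local Notation B := (ecball (0 : 'rV[R]_d) K%:E : set T).
Hypotheses (PB : P (~` B) = 0%E) (h0 : 0 < h) (h1 : h <= 1).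
Let mB : measurable B := measurable_ecball 0 K%:E.
Variable tau : 'rV[R]_d.
Implicit Types mu nu : probability T R.

Let M (mu : probability T R) := \int[mu]_u (enorm ((u : 'rV[R]_d) - tau) ^+ 2).
Let dev (mu : probability T R) := mean mu - tau.
Let J (n : R) mu := n * dot (dev mu) (dev mu) + M mu.

Let subB mu : subprob P h mu -> mu (~` B) = 0%E.
Proof. exact: (subprob_outside mB PB h0). Qed.

Let M_ge0 mu : subprob P h mu -> 0 <= M mu.
Proof.
move=> smu; apply: (expect_ge0 mB); [exact: subB|exact: bfun_sqdist|].
by move=> u _; rewrite sqr_ge0.
Qed.

Let cvg_dev (U : set_system nat) (UU : UltraFilter U) (mu_ : nat -> probability T R) mu :
  (forall g, bfun B g -> \int[mu_ n]_x g x @[n --> U] --> \int[mu]_x g x) ->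
  forall j, dev (mu_ n) 0 j @[n --> U] --> dev mu 0 j.
Proof.
move=> cv; apply: (@cvg_coordB _ _ U UU (fun n => mean (mu_ n)) (fun=> tau)) => j.
  by under eq_fun do rewrite mxE; rewrite mxE; apply: cv; exact: bfun_coord.
exact: cvg_coord_cst.
Qed.

(** Direct method: [J n] is a polynomial in finitely many expectations of functions bounded on [B],
    so it passes to the ultralimit of a minimizing sequence. *)
Lemma penalty_minimizer (n : R) : 0 <= n ->
  exists mu, subprob P h mu /\ forall nu, subprob P h nu -> J n mu <= J n nu.
Proof.
move=> n0; have [U [UU ooU]] := ultraFilterLemma (F := \oo) _.
pose S := [set r | exists2 mu, subprob P h mu & r = J n mu].
have J0 mu : subprob P h mu -> 0 <= J n mu.
  by move=> smu; rewrite addr_ge0 ?M_ge0// mulr_ge0// dot_ge0.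
have [mu0 lmu0] := local_probs_exists PB h0 h1 (inl tau).
have infS : has_inf S.
  split; first by exists (J n mu0); exists mu0 => //; exact: local_probs_subprob lmu0.
  by exists 0 => _ [mu smu ->]; exact: J0.
have ex j : exists mu, subprob P h mu /\ J n mu <= inf S + j.+1%:R^-1.
  have j0 : 0 < j.+1%:R^-1 :> R by rewrite invr_gt0.
  by have [_ [mu smu ->] /ltW] := inf_adherent j0 infS; exists mu.
have [mu_ mu_P] := choice ex.
have [|mu [smu cv]] := subprob_compact mB PB h0 UU (mu_ := mu_).
  by move=> j; have [] := mu_P j.
exists mu; split => // nu snu.
have Jcv : J n (mu_ j) @[j --> U] --> J n mu.
  apply: cvgD; last by apply: cv; exact: bfun_sqdist.
  by apply: cvgM; [exact: cvg_cst|apply: cvg_dot; exact: cvg_dev].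
have icv : inf S + j.+1%:R^-1 @[j --> U] --> inf S.
  rewrite -[X in _ --> X]addr0; apply: cvgD; first exact: cvg_cst.
  have := @cvg_harmonic R; apply: cvg_trans; exact: cvg_app.
have Jle : J n mu <= inf S.
  apply: (ler_cvg_to Jcv icv).
  by apply: nearW => j; have [] := mu_P j.
apply: (le_trans Jle); apply: ge_inf; first exact: infS.2.
by exists nu.
Qed.

(** Along the segment from [mu] to [nu], [J n] is quadratic in [t], with slope [a] at 0 and
    second-order coefficient [b]; minimality at [t = 0] gives [a >= 0]. *)
Lemma penalty_first_order (n : R) mu nu : 0 <= n -> subprob P h mu -> subprob P h nu ->
  (forall mu', subprob P h mu' -> J n mu <= J n mu') ->
  M mu + 2 * n * dot (dev mu) (dev mu) <= M nu + 2 * n * dot (dev mu) (dev nu).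
Proof.
move=> n0 smu snu Jmin.
have [D DE] : exists D, D = dev nu - dev mu by eexists.
pose a := 2 * n * dot (dev mu) D + (M nu - M mu); pose b := n * dot D D.
have b0 : 0 <= b by rewrite mulr_ge0// dot_ge0.
suff : 0 <= a by rewrite /a DE dotBr; lra.
have tab t : 0 < t -> t <= 1 -> 0 <= a + t * b.
  move=> t0 t1; have t01 : 0 <= t <= 1 by rewrite ltW.
  have [mix [smix mixE]] := subprob_mix mB PB h0 smu snu t01.
  have devE : dev mix = dev mu + t *: D.
    apply/rowP => j; rewrite DE /dev !mxE mixE; last exact: bfun_coord.
    by ring.
  have := Jmin _ smix; rewrite /J devE.
  have -> : M mix = (1 - t) * M mu + t * M nu by apply: mixE; exact: bfun_sqdist.
  rewrite dot_line => le.
  suff : 0 <= t * (a + t * b) by rewrite pmulr_rge0.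
  rewrite /a /b; lra.
rewrite leNgt; apply/negP => a0.
have ba : 0 < b - a by lra.
(* If [a < 0], this [t] lies in []0, 1]] and [t * b <= - a / 2], so [a + t * b < 0]. Dividing by
   [b - a] instead of [b] covers [b = 0]. *)
have := tab (- a / (2 * (b - a))); rewrite divr_gt0 ?mulr_gt0 ?oppr_gt0// => /(_ isT).
rewrite ler_pdivrMr ?mulr_gt0// mul1r.
have -> : (- a <= 2 * (b - a)) by lra.
move=> /(_ isT).
have -> : - a / (2 * (b - a)) * b = - a * (b / (b - a)) / 2.
  by field; rewrite gt_eqF.
have : b / (b - a) <= 1 by rewrite ler_pdivrMr//; lra.
by set c := b / (b - a); nra.
Qed.

Lemma weight_attained (w : R) :
  (forall x, (dtm2 P h x <= (enorm (x - tau) ^+ 2 + w ^+ 2)%:E)%E) ->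
  exists t mu, [/\ local_probs P h t mu, mean mu = tau & (var mu <= (w ^+ 2)%:E)%E].
Proof.
move=> dtm_le.
have ex (n : nat) : exists mu, subprob P h mu /\
    forall nu, subprob P h nu -> J n%:R mu <= J n%:R nu.
  by apply: penalty_minimizer; rewrite ler0n.
have [mu_ mu_P] := choice ex.
have smu_ n : subprob P h (mu_ n) by have [] := mu_P n.
(* The displacement from [tau] of the point at which [mu_ n] is local. *)
pose y n := - n%:R *: dev (mu_ n).
have fo n nu : subprob P h nu ->
    2 * dot (y n) (dev nu - dev (mu_ n)) <= M nu - M (mu_ n).
  move=> snu; have [_ Jmin] := mu_P n.
  have := penalty_first_order (ler0n _ n) (smu_ n) snu Jmin.
  by rewrite /y dotZl dotBr; lra.
have tauK (z : 'rV[R]_d) : tau + z - tau = z by rewrite addrAC subrr add0r.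
(* The assumed bound at [tau + y n] controls the right-hand side of the first-order condition tested
   against a measure [nu] local there; the terms [|y n|^2] cancel. *)
have bound n : M (mu_ n) + 2 * n%:R * dot (dev (mu_ n)) (dev (mu_ n)) <= w ^+ 2.
  have [nu lnu] := local_probs_exists PB h0 h1 (inl (tau + y n)).
  have snu := local_probs_subprob h0 lnu.
  have := dtm_le (tau + y n); rewrite (dtm2_local PB h0 h1 lnu) lee_fin.
  rewrite (expect_sqdist_shift (subB snu) _ tau) tauK -/(M nu) -/(dev nu).
  have := penalty_first_order (ler0n _ n) (smu_ n) snu (mu_P n).2.
  by rewrite /y dotZl; lra.
have [U [UU ooU]] := ultraFilterLemma (F := \oo) _.
have [mu [smu cv]] := subprob_compact mB PB h0 UU smu_.
have cdev := cvg_dev UU cv.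
have cM : M (mu_ n) @[n --> U] --> M mu by apply: cv; exact: bfun_sqdist.
have Mw : M mu <= w ^+ 2.
  apply: (cvgr_to_le cM); apply: nearW => n; have := bound n.
  have : 0 <= n%:R * dot (dev (mu_ n)) (dev (mu_ n)) by rewrite mulr_ge0 ?dot_ge0.
  by lra.
have dev0 : dev mu = 0.
  apply: dot_eq0; apply/le_anti; rewrite dot_ge0 andbT.
  (* For [n >= 1], [2 n >= n + 1] turns [bound] into squared deviation at most [w^2 / (n + 1)]. *)
  have c0 : w ^+ 2 * n.+1%:R^-1 @[n --> U] --> w ^+ 2 * 0.
    apply: cvgM; first exact: cvg_cst.
    have := @cvg_harmonic R; apply: cvg_trans; exact: cvg_app.
  rewrite -(mulr0 (w ^+ 2)); apply: (ler_cvg_to (cvg_dot UU cdev cdev) c0).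
  have : \forall n \near \oo, (1 <= n)%N by exists 1%N.
  move=> /ooU; apply: filterS => n n1.
  rewrite ler_pdivlMr//.
  have := bound n; have := M_ge0 (smu_ n); have := dot_ge0 (dev (mu_ n)).
  have : 1 <= n%:R :> R by rewrite ler1n.
  rewrite -[n.+1]addn1 natrD; set e := dot _ _; set N := n%:R; nra.
have mtau : mean mu = tau by apply/eqP; rewrite -subr_eq0; apply/eqP.
suff [t lt] : exists t, local_probs P h t mu.
  exists t, mu; split => //.
  by rewrite (var_EFin (subB smu)) mtau lee_fin.
(* Along the ultrafilter, [y n] either stays bounded, and the limit is local at a finite point, or
   tends to infinity in norm. *)
have [[C yC]|nC] := pselect (exists C, U [set n | enorm (y n) <= C]).
- have [y' cy] := ultra_bounded_coord_cvg UU yC.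
  exists (inl (tau + y')).
  have [nu lnu] := local_probs_exists PB h0 h1 (inl (tau + y')).
  have snu := local_probs_subprob h0 lnu.
  apply: (minimizer_local_probs PB h0 h1 lnu smu) => /=.
  rewrite (expect_sqdist_shift (subB smu) (tau + y') tau).
  rewrite (expect_sqdist_shift (subB snu) (tau + y') tau) tauK -/(M nu) -/(M mu) -/(dev nu) -/(dev mu).
  rewrite lerD2r dev0.
  have lim : 2 * dot y' (dev nu - dev mu) <= M nu - M mu.
    apply: (@ler_cvg_to _ U _ _ (fun n => 2 * dot (y n) (dev nu - dev (mu_ n)))
      (fun n => M nu - M (mu_ n))).
    + apply: cvgM; first exact: cvg_cst.
      apply: cvg_dot => //; apply: cvg_coordB => //; exact: cvg_coord_cst.
    + by apply: cvgB => //; exact: cvg_cst.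
    + by apply: nearW => n; exact: fo.
  by move: lim; rewrite dotBr dev0; lra.
- have big C : \forall n \near U, C < enorm (y n).
    have [UC|] := in_ultra_setVsetC [set n | enorm (y n) <= C] UU.
      by case: nC; exists C.
    by apply: filterS => n /negP; rewrite -ltNge.
  pose r n := (enorm (y n))^-1.
  have r0 : r n @[n --> U] --> (0 : R).
    apply/cvgrPdist_le => e e0; have := big e^-1; apply: filterS => n en.
    have yn : 0 < enorm (y n) by apply: lt_trans en; rewrite invr_gt0.
    rewrite sub0r normrN ger0_norm ?invr_ge0 ?enorm_ge0//.
    by rewrite -[e]invrK lef_pV2 ?posrE ?invr_gt0// ltW.
  pose v n := r n *: y n.
  have v1 : \forall n \near U, dot (v n) (v n) = 1.
    have := big 0; apply: filterS => n yn.
    by rewrite /v dotZl dotZr -enorm_sqr /r expr2 mulKf ?mulVf ?gt_eqF.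
  have vb : \forall n \near U, enorm (v n) <= 1.
    by apply: filterS v1 => n vn; rewrite /enorm vn sqrtr1.
  have [v' cv'] := ultra_bounded_coord_cvg UU vb.
  have vv1 : enorm v' = 1.
    rewrite /enorm; suff -> : dot v' v' = 1 by rewrite sqrtr1.
    have c1 := cvg_dot UU cv' cv'.
    apply/le_anti/andP; split.
      by apply: (cvgr_to_le c1); apply: filterS v1 => n ->.
    by apply: (cvgr_to_ge c1); apply: filterS v1 => n ->.
  pose t : extended_space R d := inr (exist _ v' vv1).
  exists t.
  have [nu lnu] := local_probs_exists PB h0 h1 t.
  have snu := local_probs_subprob h0 lnu.
  apply: (minimizer_local_probs PB h0 h1 lnu smu) => /=.
  rewrite !(expectN mB) ?subB//; try exact: bfun_dot.
  rewrite !(expect_dot (subB _))// lerN2.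
  (* The first-order inequality divided by [|y n|]: its right-hand side vanishes in the limit,
     leaving the linear loss in the limit direction [v']. *)
  have lim : 2 * dot v' (dev nu - dev mu) <= 0 * (M nu - M mu).
    apply: (@ler_cvg_to _ U _ _ (fun n => 2 * dot (v n) (dev nu - dev (mu_ n)))
      (fun n => r n * (M nu - M (mu_ n)))).
    + apply: cvgM; first exact: cvg_cst.
      apply: cvg_dot => //; apply: cvg_coordB => //; exact: cvg_coord_cst.
    + by apply: cvgM => //; apply: cvgB => //; exact: cvg_cst.
    + apply: nearW => n; rewrite /v dotZl mulrCA ler_wpM2l ?fo//.
      by rewrite invr_ge0 enorm_ge0.
  move: lim; rewrite mul0r dev0 subr0 /dev dotBr -mtau.
  by rewrite (dotC v') (dotC v'); lra.
Qed.
End weights.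

(** * Uniqueness of local measures at infinity *)

Section support.
Context {R : realType} {d : nat}.
Local Notation T := (borel_rV R d).
Variable P : probability T R.

Let rat_ball (q : 'rV[rat]_d) (n : nat) : set 'rV[R]_d :=
  ball (map_mx ratr q : 'rV[R]_d) n.+1%:R^-1.

Lemma rat_ball_basis (U : set 'rV[R]_d) x : open U -> U x ->
  exists q n, rat_ball q n x /\ rat_ball q n `<=` U.
Proof.
move=> oU Ux.
have /nbhs_ballP [e /= e0 xU] : nbhs x U by apply: open_nbhs_nbhs.
have e2 : 0 < e / 2 by rewrite divr_gt0.
have := near_infty_natSinv_lt (PosNum e2); move=> [n _ /(_ n (leqnn n))] /= ne.
have n0 : 0 < n.+1%:R^-1 :> R by rewrite invr_gt0.
have ex j : exists q : rat, `|ratr q - x 0 j| < n.+1%:R^-1.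
  have : x 0 j - n.+1%:R^-1 < x 0 j + n.+1%:R^-1.
    by rewrite ltrBlDr -addrA ltrDl addr_gt0.
  move=> /rat_in_itvoo [q]; rewrite in_itv/= => /andP[q1 q2].
  by exists q; rewrite ltr_norml ltrBrDl q1 ltrBlDl.
have [q qP] := choice ex.
have qx : rat_ball (\row_j q j) n x.
  split=> // i j; rewrite /ball/= !mxE ord1.
  by have := qP j; rewrite /ball_/=.
exists (\row_j q j), n; split => // z qz; apply: xU.
exact: ball_splitr (le_ball (ltW ne) qx) (le_ball (ltW ne) qz).
Qed.

(** A point outside the support has a null neighbourhood, hence lies in a null rational ball, and
    there are only countably many of these. *)
Lemma supp_null (C : set T) : measurable C -> supp P `<=` C -> P (~` C) = 0%E.
Proof.
move=> mC suppC.
(* Enumeration of the null rational balls, the other indices giving the empty set. *)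
pose W (k : nat) : set T := match unpickle k with
  | Some (q, n) => if P (rat_ball q n) == 0%E then rat_ball q n else set0
  | None => set0 end.
have mball q n : measurable (rat_ball q n : set T).
  by apply: open_measurable_rV; exact: ball_open.
have mW k : measurable (W k) /\ P (W k) = 0%E.
  rewrite /W; case: unpickle => [[q n]|]; last by rewrite measure0.
  by case: eqP => [->|_]; rewrite ?measure0.
have PW : P (\bigcup_k W k) = 0%E.
  apply: measure_negligible.
    by apply: bigcupT_measurable => k; have [] := mW k.
  apply: negligible_bigcup => k; have [mk Pk] := mW k.
  by exists (W k); split => // x.
have mCC := measurableC mC.
have mU : measurable (\bigcup_k W k) by apply: bigcupT_measurable => k; have [] := mW k.
apply/eqP; rewrite eq_le measure_ge0 andbT -PW; apply: le_measure; rewrite ?inE//.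
move=> x Cx; have : ~ supp P x by move=> /suppC.
move=> /existsNP [U /not_implyP [oU /not_implyP [Ux /negP]]].
rewrite -leNgt => PU.
have [q [n [qx qU]]] := rat_ball_basis oU Ux.
exists (pickle (q, n)) => //; rewrite /W pickleK.
suff -> : P (rat_ball q n) = 0%E by rewrite eqxx.
apply/eqP; rewrite eq_le measure_ge0 andbT (le_trans _ PU)//.
by apply: le_measure; rewrite ?inE//; exact: open_measurable_rV.
Qed.

(** From a point of the hyperplane, small moves along [v] and [- v] reach the half-space and its
    complement. *)
Lemma hyperplane_boundary (v : 'rV[R]_d) (c : R) : enorm v = 1 ->
  [set u | dot u v = c] `<=` boundary (halfspace v c%:E).
Proof.
move=> v1 u /= uc.
have vv : dot v v = 1 by rewrite -enorm_sqr v1 expr1n.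
have step (B : set 'rV[R]_d) : nbhs u B ->
    exists e, [/\ 0 < e, B (u + e *: v) & B (u - e *: v)].
  move=> /nbhs_ballP [r /= r0 rB]; exists (r / 2); have r2 : 0 < r / 2 by rewrite divr_gt0.
  have ev j : `|r / 2 * v 0 j| < r.
    rewrite normrM gtr0_norm//; apply: (@le_lt_trans _ _ (r / 2 * 1)).
      by rewrite ler_wpM2l ?(ltW r2)// -v1 coord_le_enorm.
    by rewrite mulr1 ltr_pdivrMr// mulr_natr mulr2n ltrDl.
  split=> //; apply: rB; split=> // i j; rewrite /ball/= !mxE ord1.
    by rewrite opprD addNKr normrN.
  by rewrite opprB addrC subrK.
split.
- move=> B /step [e [e0 Bp _]]; exists (u + e *: v); split => //.
  by rewrite /halfspace/= lte_fin dotDl dotZl vv uc mulr1 ltrDl.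
- move=> /step [e [e0 _]]; rewrite /halfspace/= lte_fin dotBl dotZl vv uc mulr1.
  by rewrite ltrBrDr gtrDl ltNge (ltW e0).
Qed.

Lemma boundary_measurable (A : set 'rV[R]_d) : measurable (boundary A : set T).
Proof.
apply: measurableD.
- rewrite -[closure A]setCK; apply: measurableC; apply: open_measurable_rV.
  by apply: closed_openC; exact: closed_closure.
- by apply: open_measurable_rV; exact: open_interior.
Qed.
End support.

Section uniqueness.
Context dd (T : measurableType dd) (R : realType).
Variables (P : probability T R) (h : R) (psi : T -> R) (c : R).
Hypotheses (h0 : 0 < h) (mpsi : measurable_fun setT psi).

(** Only the level set leaves any freedom; when it is null, [h mu] is the restriction of [P] to
    [psi < c]. *)
Lemma local_at_unique mu mu' : P [set x | psi x = c] = 0%E ->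
  local_at P h psi c mu -> local_at P h psi c mu' ->
  forall A, measurable A -> mu A = mu' A.
Proof.
move=> P0.
have [mle mlt mge mgt] := measurable_sublevel c mpsi.
pose L := [set x | psi x < c].
have key nu : local_at P h psi c nu -> forall A, measurable A ->
    fine (nu A) = h^-1 * fine (P (A `&` L)).
  move=> [snu nuL nuG] A mA.
  have mAL : measurable (A `&` L) by exact: measurableI.
  have mAD : measurable (A `\` L) by exact: measurableD.
  have -> : nu A = (nu (A `&` L) + nu (A `\` L))%E.
    rewrite -measureU ?setUIDK//.
    by apply/seteqP; split => // x [[_ Lx] [_ nLx]].
  have -> : nu (A `\` L) = 0%E.
    have mE : measurable [set x | psi x = c].
      have -> : [set x | psi x = c] = [set x | psi x <= c] `&` [set x | c <= psi x].
        apply/seteqP; split => x /=; first by move=> ->; rewrite lexx.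
        by move=> [a b]; apply/le_anti; rewrite a b.
      exact: measurableI.
    have nE : nu [set x | psi x = c] = 0%E.
      rewrite -[nu _]fineP//; congr EFin; apply/eqP; rewrite eq_le fine_ge0// andbT.
      by have := snu _ mE; rewrite P0/= pmulr_rle0.
    apply/eqP; rewrite eq_le measure_ge0 andbT.
    apply: (@le_trans _ _ (nu ([set x | psi x = c] `|` [set x | c < psi x]))).
      rewrite le_measure ?inE//; first exact: measurableU.
      move=> x [_ /negP]; rewrite -leNgt /= le_eqVlt => /orP[/eqP->|]; by [left|right].
    have -> : 0%E = (nu [set x | psi x = c] + nu [set x | (c < psi x)%R])%E.
      by rewrite nE nuG adde0.
    exact: measureU2.
  have AL : A `&` L `<=` L by move=> x [].
  by rewrite adde0 -(nuL _ mAL AL) mulKf// gt_eqF.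
move=> /key k1 /key k2 A mA.
by rewrite -[LHS]fineP// -[RHS]fineP// k1// k2.
Qed.
End uniqueness.

Section dependence.
Context {R : realType} {d : nat}.

(** The square matrix with rows [(1, p j)] kills the nonzero column [(- c, v)], so it is singular; a
    nonzero vector of its left kernel is an affine dependence. *)
Lemma hyperplane_dependent (p : 'I_d.+1 -> 'rV[R]_d) (v : 'rV[R]_d) (c : R) :
  v != 0 -> (forall j, dot (p j) v = c) ->
  exists w : 'I_d.+1 -> R, [/\ exists j, w j != 0, \sum_j w j = 0 & \sum_j w j *: p j = 0].
Proof.
move=> v0 pc.
pose M : 'M[R]_(d.+1, 1 + d) := \matrix_j row_mx (1%:M : 'M[R]_1) (p j).
pose x : 'M[R]_(1 + d, 1) := col_mx (- c)%:M v^T.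
have Mx : M *m x = 0.
  apply/row_matrixP => j; rewrite row_mul rowK row0 mul_row_col mul1mx.
  apply/matrixP => a b; rewrite !ord1 !mxE eqxx mulr1n.
  by under eq_bigr do rewrite mxE; rewrite -/(dot (p j) v) pc addNr.
have x0 : x != 0.
  by apply: contraNneq v0 => /(congr1 dsubmx); rewrite col_mxKd linear0 => /(canRL trmxK) ->; rewrite linear0.
have : kermx M != 0.
  rewrite kermx_eq0 (row_free_unit (M : 'M[R]_(d.+1))); apply: contraNN x0 => uM.
  by rewrite -[x](mulKmx uM) Mx mulmx0.
move=> /rowV0Pn [w /sub_kermxP wM w0].
exists (fun j => w 0 j).
have E : \sum_j w 0 j *: row_mx (1%:M : 'M[R]_1) (p j) = 0.
  rewrite -[RHS]wM mulmx_sum_row.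
  by apply: eq_bigr => j _; rewrite rowK.
split.
- apply: contrapT => H; move/eqP: w0; apply; apply/rowP => j; rewrite mxE.
  by apply/eqP; apply: contrapT => /negP wj; apply: H; exists j.
- have := congr1 lsubmx E; rewrite linear0 linear_sum => /matrixP /(_ 0 0).
  rewrite summxE [X in _ = X]mxE => E00; rewrite -[RHS]E00.
  by apply: eq_bigr => j _; rewrite linearZ/= row_mxKl !mxE eqxx mulr1.
- have := congr1 rsubmx E; rewrite linear0 linear_sum => Er; rewrite -[RHS]Er.
  by apply: eq_bigr => j _; rewrite linearZ/= row_mxKr.
Qed.
End dependence.

Section halfspace_uniqueness.
Context {R : realType} {d : nat}.
Local Notation T := (borel_rV R d).
Variables (P : probability T R) (K h : R).
Local Notation B := (ecball (0 : 'rV[R]_d) K%:E : set T).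
Hypotheses (PB : P (~` B) = 0%E) (h0 : 0 < h) (h1 : h <= 1).
Implicit Types mu nu : probability T R.

(** The level set of the loss at the cut is a hyperplane contained in the boundary of the
    half-space, which is [P]-null by assumption. *)
Lemma regular_halfspace_unique v mu mu' :
  (forall v : 'rV[R]_d, enorm v = 1 -> P (boundary (halfspace v (cut P h v))) = 0%E) ->
  local_probs P h (inr v) mu -> local_probs P h (inr v) mu' ->
  forall A, measurable A -> mu A = mu' A.
Proof.
move=> Pbd lmu lmu' A mA.
have [h1'|h1'] := ltP h 1; last first.
  have h1E : h = 1 by apply/le_anti; rewrite h1 h1'.
  rewrite (subprob_full h1E (local_probs_subprob h0 lmu))//.
  by rewrite (subprob_full h1E (local_probs_subprob h0 lmu')).
have [c [E _ _]] := cut_threshold PB h0 (sval v) h1'.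
move/(local_probs_halfspace h0 _ E): lmu => lmu.
move/(local_probs_halfspace h0 _ E): lmu' => lmu'.
have [mloss _] := bfun_loss K (inr v).
apply: (local_at_unique h0 mloss _ lmu lmu') => //.
have v1 := svalP v; rewrite /= in v1.
apply/eqP; rewrite eq_le measure_ge0 andbT -(Pbd _ v1); apply: le_measure; rewrite ?inE.
- have [m1 _ _ _] := measurable_sublevel (- c) mloss.
  have [_ _ m2 _] := measurable_sublevel (- c) mloss.
  rewrite (_ : [set x | _] = [set x | loss (inr v) x <= - c] `&` [set x | - c <= loss (inr v) x]).
    exact: measurableI.
  apply/seteqP; split => x /=; first by move=> ->; rewrite lexx.
  by move=> [a b]; apply/le_anti; rewrite a b.
- exact: boundary_measurable.
- rewrite E => u /= /oppr_inj uc; exact: hyperplane_boundary.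
Qed.

End halfspace_uniqueness.

(** * Uniform measures on points in general position *)

Section finite_support.
Context {R : realType} {d n : nat}.
Local Notation T := (borel_rV R d).
Variable p : 'I_n -> 'rV[R]_d.
Hypothesis pinj : injective p.
Local Notation S := (range p : set T).
Implicit Types mu nu : probability T R.

Lemma measurable_point (x : 'rV[R]_d) : measurable ([set x] : set T).
Proof.
have -> : [set x] = ecball x 0%:E.
  apply/seteqP; split => y; rewrite /ecball/= lee_fin.
    by move=> ->; rewrite subrr /enorm (_ : dot 0 0 = 0) ?sqrtr0// -(scale0r 0) dotZl mul0r.
  move=> yx; apply/eqP; rewrite -subr_eq0; apply/eqP/dot_eq0.
  by rewrite -enorm_sqr (_ : enorm _ = 0) ?expr0n//; apply/le_anti; rewrite yx enorm_ge0.
exact: measurable_ecball.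
Qed.

Lemma measurable_points : measurable S.
Proof.
have -> : S = \bigcup_(i in [set: 'I_n]) [set p i].
  apply/seteqP; split => x; first by move=> [i _ <-]; exists i.
  by move=> [i _ ->]; exists i.
apply: fin_bigcup_measurable; first exact: finite_finset.
by move=> i _; exact: measurable_point.
Qed.

Lemma bfun_points (g : T -> R) : measurable_fun setT g -> bfun S g.
Proof.
move=> mg; split => //; exists (\sum_i `|g (p i)|) => _ [i _ <-].
by rewrite (bigD1 i)//= lerDl sumr_ge0.
Qed.

Lemma expect_points mu (g : T -> R) : mu (~` S) = 0%E -> measurable_fun setT g ->
  \int[mu]_x g x = \sum_i fine (mu [set p i]) * g (p i).
Proof.
move=> mu0 mg; have mS := measurable_points.
have bI i : bfun S (fun x => g (p i) * \1_[set p i] x).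
  by apply: bfunZ; apply: bfun_indic; exact: measurable_point.
transitivity (\int[mu]_x \sum_i g (p i) * \1_[set p i] x).
  have E x : S x -> g x = \sum_i g (p i) * \1_[set p i] x.
    move=> [j _ <-]; rewrite (bigD1 j)//= big1 ?addr0; last first.
      move=> i ij; rewrite indicE memNset ?mulr0//= => /pinj ji.
      by rewrite ji eqxx in ij.
    by rewrite indicE mem_set ?mulr1.
  apply/le_anti/andP; split; apply: (expect_le mS) => //; try exact: bfun_points;
    try exact: bfun_sum; by move=> x /E ->.
rewrite (expect_sum mS)//; apply: eq_bigr => i _.
rewrite (expectZ mS)//; last by apply: bfun_indic; exact: measurable_point.
by rewrite mulrC (expect_indic mu (measurable_point (p i))).
Qed.

(** If there were more, [d + 1] of them would form a set small enough for general position, yet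
    affinely dependent by [hyperplane_dependent]. *)
Lemma hyperplane_card (v : 'rV[R]_d) c : v != 0 -> general_position p ->
  (#|[set i | dot (p i) v == c]%SET| <= d.+1)%N.
Proof.
move=> v0 gp; set I0 := [set i | _]%SET; rewrite leqNgt; apply/negP => dI.
pose f (j : 'I_d.+1) : 'I_n := enum_val (widen_ord (ltnW dI) j).
have finj : injective f by move=> j j' /enum_val_inj/(congr1 val)/= /val_inj.
have fc j : dot (p (f j)) v = c.
  by have := enum_valP (widen_ord (ltnW dI) j); rewrite inE => /eqP.
have [w [[j0 wj0] w1 wp]] := hyperplane_dependent v0 fc.
pose A := [set f j | j in [set: 'I_d.+1]%SET]%SET.
have cA : (#|A| <= d.+1)%N by rewrite card_imset// cardsT card_ord.
(* The dependence transported along the injection [f]; the sum is empty off its image. *)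
pose w' i := \sum_(j | f j == i) w j.
have w'f j : w' (f j) = w j.
  by rewrite /w' (big_pred1 j)// => j'; rewrite (inj_eq finj).
have sumA (V : zmodType) (G : 'I_n -> V) : \sum_(i in A) G i = \sum_j G (f j).
  rewrite big_imset /=; last by move=> ? ? _ _; exact: finj.
  by apply: eq_bigl => j; rewrite inE.
have := gp A cA w'; rewrite !sumA.
under eq_bigr do rewrite w'f; move=> /(_ w1).
under eq_bigr do rewrite w'f; move=> /(_ wp (f j0)).
rewrite w'f => E; move/eqP: wj0; apply; apply: E.
by apply: imset_f; rewrite inE.
Qed.

Variables (P : probability T R) (h : R).
Hypotheses (unifP : uniform_on p P) (h0 : 0 < h) (h1 : h <= 1).

Lemma uniform_outside (A : set T) : measurable A -> S `<=` A -> P (~` A) = 0%E.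
Proof.
move=> mA SA; rewrite unifP; last exact: measurableC.
rewrite big1 ?mule0// => i _; rewrite diracE memNset//.
by apply; apply: SA; exists i.
Qed.

Lemma points_in_ball : P (~` (ecball 0 (\sum_i enorm (p i))%:E : set T)) = 0%E.
Proof.
apply: uniform_outside; first exact: measurable_ecball.
move=> _ [i _ <-]; rewrite /ecball/= subr0 lee_fin (bigD1 i)//= lerDl.
by apply: sumr_ge0 => j _; exact: enorm_ge0.
Qed.

(** The two measures can differ only at atoms on the hyperplane. There the weight differences sum to
    0 and, the means being equal, have zero barycentric sum; affine independence makes them
    vanish. *)
Lemma general_position_halfspace_unique v mu mu' : general_position p ->
  local_probs P h (inr v) mu -> local_probs P h (inr v) mu' -> mean mu = mean mu' ->
  forall A, measurable A -> mu A = mu' A.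
Proof.
move=> gp lmu lmu' mm A mA.
have PB := points_in_ball; have mS := measurable_points.
have smu := local_probs_subprob h0 lmu; have smu' := local_probs_subprob h0 lmu'.
have [h1'|h1'] := ltP h 1; last first.
  have h1E : h = 1 by apply/le_anti; rewrite h1 h1'.
  by rewrite (subprob_full h1E smu)// (subprob_full h1E smu').
have PS : P (~` S) = 0%E by exact: uniform_outside.
have z := subprob_outside mS PS h0 smu; have z' := subprob_outside mS PS h0 smu'.
have [c [E _ _]] := cut_threshold PB h0 (sval v) h1'.
move/(local_probs_halfspace h0 _ E): lmu => [_ muL muG].
move/(local_probs_halfspace h0 _ E): lmu' => [_ muL' muG'].
pose w i := fine (mu [set p i]) - fine (mu' [set p i]).
have wsum (g : T -> R) : measurable_fun setT g ->
    \sum_i w i * g (p i) = \int[mu]_x g x - \int[mu']_x g x.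
  move=> mg; rewrite !expect_points// -sumrB.
  by apply: eq_bigr => i _; rewrite mulrBl.
pose I0 := [set i | dot (p i) (sval v) == c]%SET.
(* On the inner side both measures equal [P / h]; on the outer side both vanish. *)
have w0 i : i \notin I0 -> w i = 0.
  rewrite inE neq_lt => /orP[lt_c|gt_c]; rewrite /w.
    have G0 nu : nu [set x | - c < loss (inr v) x] = 0%E -> fine (nu [set p i]) = 0.
      move=> nuG; rewrite (_ : nu _ = 0%E)//.
      apply/eqP; rewrite eq_le measure_ge0 andbT -nuG.
      apply: le_measure; rewrite ?inE//; first exact: measurable_point.
        have [mloss _] := bfun_loss 0 (inr v).
        by have [] := measurable_sublevel (- c) mloss.
      by move=> _ ->; rewrite /= ltrN2.
    by rewrite !G0// subrr.
  have iL : [set p i] `<=` [set x | loss (inr v) x < - c].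
    by move=> _ ->; rewrite /= ltrN2.
  apply: (mulfI (lt0r_neq0 h0)); rewrite mulr0 mulrBr.
  by rewrite muL ?muL' ?subrr//; exact: measurable_point.
have sumI (V : zmodType) (F : 'I_n -> V) : (forall i, i \notin I0 -> F i = 0) ->
    \sum_(i in I0) F i = \sum_i F i.
  move=> F0; rewrite big_mkcond; apply: eq_bigr => i _.
  by case: ifPn => // /F0.
have v0 : sval v != 0.
  apply/eqP => v0; have := svalP v; rewrite v0 /= /enorm (_ : dot 0 0 = 0) ?sqrtr0.
    by move=> /eqP; rewrite eq_sym oner_eq0.
  by rewrite -(scale0r 0) dotZl mul0r.
have wI0 := gp _ (hyperplane_card c v0 gp) w.
have w1 : \sum_(i in I0) w i = 0.
  rewrite sumI//; have := wsum (cst 1) (@measurable_cst _ _ _ _ _ _).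
  by rewrite !expect_cst subrr; under eq_bigr do rewrite mulr1.
have wp : \sum_(i in I0) w i *: p i = 0.
  rewrite sumI => [|i /w0 ->]; last by rewrite scale0r.
  apply/rowP => j; rewrite summxE mxE.
  transitivity (\sum_i w i * p i 0 j); first by apply: eq_bigr => i _; rewrite mxE.
  rewrite (wsum (fun u : T => (u : 'rV[R]_d) 0 j)); last exact: measurable_coord.
  by have := congr1 (fun m : 'rV[R]_d => m 0 j) mm; rewrite !mxE => ->; rewrite subrr.
have wz i : w i = 0.
  by have [iI|/w0//] := boolP (i \in I0); exact: wI0.
rewrite -[LHS]fineP// -[RHS]fineP//; congr EFin.
rewrite -!expect_indic//; apply/eqP; rewrite -subr_eq0.
rewrite -wsum; last exact: measurable_indic.
by rewrite big1// => i _; rewrite wz mul0r.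
Qed.
End finite_support.

(** * Weights at local means and comparison of the two minimization problems *)

Section local_weights.
Context {R : realType} {d : nat}.
Local Notation T := (borel_rV R d).
Variables (P : probability T R) (K h : R).
Local Notation B := (ecball (0 : 'rV[R]_d) K%:E : set T).
Hypotheses (PB : P (~` B) = 0%E) (h0 : 0 < h) (h1 : h <= 1).
Hypothesis halfspace_unique : forall v (mu mu' : probability T R),
  local_probs P h (inr v) mu -> local_probs P h (inr v) mu' -> mean mu = mean mu' ->
  forall A, measurable A -> mu A = mu' A.
Let mB : measurable B := measurable_ecball 0 K%:E.
Implicit Types (mu nu : probability T R) (t : extended_space R d).

Let subB t mu : local_probs P h t mu -> mu (~` B) = 0%E.
Proof. by move=> /(local_probs_subprob h0)/(subprob_outside mB PB h0). Qed.

Lemma omega2_mean t mu : local_probs P h t mu -> omega2 P h (mean mu) = var mu.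
Proof.
move=> lmu; have muB := subB lmu; have smu := local_probs_subprob h0 lmu.
rewrite (var_EFin muB); set V := \int[mu]_u _.
have V0 : 0 <= V.
  by apply: (expect_ge0 mB); [|exact: bfun_sqdist|move=> u _; rewrite sqr_ge0].
have valid w : V <= w ^+ 2 ->
    forall x, (dtm2 P h x <= (enorm (x - mean mu) ^+ 2 + w ^+ 2)%:E)%E.
  move=> Vw x; have [nu lnu] := local_probs_exists PB h0 h1 (inl x).
  rewrite (dtm2_local PB h0 h1 lnu) lee_fin.
  apply: (le_trans (local_probs_minimizes PB h0 h1 lnu smu)) => /=.
  by rewrite (expect_sqdist_mean muB) addrC lerD2l.
have valid_ge w :
    (forall x, (dtm2 P h x <= (enorm (x - mean mu) ^+ 2 + w ^+ 2)%:E)%E) -> V <= w ^+ 2.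
  (* At a finite point the bound at [x] itself is sharp. At infinity, [weight_attained] gives a
     local measure [mu'] with the same mean; the linear loss depends on the mean only, so [mu'] is
     also local at [v] and equals [mu]. *)
  move=> dw; case: t lmu => [x|v] lmu.
    have := dw x; rewrite (dtm2_local PB h0 h1 lmu) lee_fin (expect_sqdist_mean muB).
    by rewrite -/V addrC lerD2l.
  have [t' [mu' [lmu' mm vw]]] := weight_attained PB h0 h1 dw.
  have smu' := local_probs_subprob h0 lmu'; have muB' := subB lmu'.
  have lv : local_probs P h (inr v) mu'.
    apply: (minimizer_local_probs PB h0 h1 lmu smu') => /=.
    by rewrite !(expectN mB)//; try exact: bfun_dot; rewrite (expect_dot muB) (expect_dot muB') mm.
  have E := halfspace_unique lmu lv (esym mm).
  move: vw; rewrite (var_EFin muB') lee_fin mm.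
  by rewrite /V (eq_expect _ E).
have s0 : 0 <= Num.sqrt V by rewrite sqrtr_ge0.
have -> : V%:E = ((Num.sqrt V)%:E ^+ 2)%E by rewrite -EFin_expe sqr_sqrtr.
rewrite /omega2; congr (_ ^+ 2)%E; apply/eqP; rewrite eq_le; apply/andP; split.
(* [omega] ranges over positive [w], and the variance may be 0, hence the added [e]. *)
- apply/lee_addgt0Pr => e e0; apply: ereal_inf_lbound.
  exists (Num.sqrt V + e) => //=; split; first by rewrite ltr_wpDl.
  apply: valid; rewrite -{1}(sqr_sqrtr V0) ler_pXn2r ?nnegrE ?addr_ge0 ?(ltW e0)//.
  by rewrite lerDl ltW.
- apply: le_ereal_inf_tmp => _ [w [w0 /valid_ge Vw] <-]; rewrite lee_fin.
  by rewrite -(ger0_norm (ltW w0)) -sqrtr_sqr ler_wsqrtr.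
Qed.

(** Any admissible [w], even far from optimal, yields a local measure with mean [tau], and
    [omega2_mean] then identifies its variance. *)
Lemma omega2_attained tau : (omega2 P h tau < +oo)%E ->
  exists t mu, [/\ local_probs P h t mu, mean mu = tau & var mu = omega2 P h tau].
Proof.
move=> fin; have omega_fin : (omega P h tau < +oo)%E.
  rewrite ltNge leye_eq; apply/negP => /eqP E.
  by move: fin; rewrite /omega2 E.
have [_ [w [w0 dw] <-] _] := ereal_inf_lt omega_fin.
have [t [mu [lmu mm _]]] := weight_attained PB h0 h1 dw.
by exists t, mu; rewrite -mm (omega2_mean lmu).
Qed.

Section tuples.
Variable k : nat.
Implicit Types (tau theta : 'I_k -> 'rV[R]_d) (f : 'rV[R]_d -> R).

Lemma power_dist2_infinite tau (w : 'I_k -> \bar R) x :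
  (forall i, w i = +oo%E) -> power_dist2 tau w x = +oo%E.
Proof.
move=> wy; apply/eqP; rewrite -leye_eq; apply/bigmin_geP.
by split => // i _; rewrite wy addey.
Qed.

(** Centres of finite weight are means of local measures. Those of infinite weight never realize the
    minimum, and are replaced by copies of the centre [tau i0]. *)
Lemma power_dist2_attained tau i0 : (omega2 P h (tau i0) < +oo)%E ->
  exists (s : 'I_k -> extended_space R d) (nu : 'I_k -> probability T R),
    (forall i, local_probs P h (s i) (nu i)) /\
    forall x, power_dist2 (@mean R d \o nu) (@var R d \o nu) x =
              power_dist2 tau (omega2 P h \o tau) x.
Proof.
move=> fin0.
have ex i : exists q : extended_space R d * probability T R,
    local_probs P h q.1 q.2 /\
    exists j, [/\ mean q.2 = tau j, var q.2 = omega2 P h (tau j) &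
      (omega2 P h (tau i) < +oo)%E -> j = i].
  have [fin|inf] := boolP (omega2 P h (tau i) < +oo)%E.
    have [t [mu [lmu mm vm]]] := omega2_attained fin.
    by exists (t, mu); split => //; exists i.
  have [t [mu [lmu mm vm]]] := omega2_attained fin0.
  by exists (t, mu); split => //; exists i0; split => // /idP; rewrite (negbTE inf).
have [q qP] := choice ex.
exists (fun i => (q i).1), (fun i => (q i).2); split; first by move=> i; have [] := qP i.
move=> x; rewrite /power_dist2; apply/eqP; rewrite eq_le; apply/andP; split.
- apply/bigmin_geP; split => [|i _]; first by rewrite leey.
  have [_ [j [mj vj ji]]] := qP i.
  have [fin|inf] := boolP (omega2 P h (tau i) < +oo)%E.
    by apply: (le_trans (bigmin_le _ i _)); rewrite /= mj vj ji.
  rewrite /= (_ : omega2 _ _ (tau i) = +oo%E) ?addey ?leey//=.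
  by move: inf; rewrite -leNgt leye_eq => /eqP.
- apply/bigmin_geP; split => [|i _]; first by rewrite leey.
  have [_ [j [mj vj _]]] := qP i.
  by apply: (le_trans (bigmin_le _ j _)); rewrite /= mj vj.
Qed.

Lemma risk_infinite tau :
  (forall i, omega2 P h (tau i) = +oo%E) -> risk P tau (omega2 P h \o tau) = +oo%E.
Proof.
move=> oy; rewrite /risk.
have -> : power_dist2 tau (omega2 P h \o tau) = cst +oo%E.
  by apply/funext => x; exact: power_dist2_infinite.
transitivity (+oo * P setT)%E; first exact: integral_cst.
by rewrite probability_setT mule1.
Qed.

(** A competitor [tau] either has all weights infinite, hence infinite risk, or has the same power
    function as a tuple of local measures. *)
Lemma pdtm_OPT s (nu : 'I_k -> probability T R) : pdtm_optimal P h s nu -> OPT P h k (@mean R d \o nu).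
Proof.
move=> [lnu opt] tau.
have -> : omega2 P h \o (@mean R d \o nu) = @var R d \o nu.
  by apply/funext => i; exact: omega2_mean (lnu i).
have [[i fin]|inf] := pselect (exists i, (omega2 P h (tau i) < +oo)%E).
  have [s' [nu' [lnu' E]]] := power_dist2_attained fin.
  have -> : risk P tau (omega2 P h \o tau) = risk P (@mean R d \o nu') (@var R d \o nu').
    by rewrite /risk; congr (integral _ _ _); apply/funext => x; rewrite E.
  exact: opt.
rewrite risk_infinite ?leey// => i; apply/eqP; rewrite -leye_eq leNgt.
by apply/negP => fin; apply: inf; exists i.
Qed.

Hypothesis k0 : (0 < k)%N.

Lemma OPT_finite theta : OPT P h k theta -> exists i, (omega2 P h (theta i) < +oo)%E.
Proof.
move=> opt; apply: contrapT => inf.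
(* Repeating the mean of one local measure gives a competitor of finite risk. *)
have [mu lmu] := local_probs_exists PB h0 h1 (inl 0).
have := opt (fun=> mean mu); rewrite risk_infinite; last first.
  move=> i; apply/eqP; rewrite -leye_eq leNgt.
  by apply/negP => fin; apply: inf; exists i.
rewrite leye_eq => /eqP.
have muB := subB lmu; pose V := \int[mu]_u (enorm ((u : 'rV[R]_d) - mean mu) ^+ 2).
have -> : risk P (fun=> mean mu) (omega2 P h \o (fun=> mean mu) : 'I_k -> _) =
    (\int[P]_u (enorm ((u : 'rV[R]_d) - mean mu) ^+ 2 + V)%:E)%E.
  apply: eq_integral => u _; rewrite /power_dist2.
  under eq_bigr do rewrite /= (omega2_mean lmu) (var_EFin muB).
  apply/eqP; rewrite eq_le; apply/andP; split.
    exact: (le_trans (bigmin_le _ (Ordinal k0) _)).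
  by apply/bigmin_geP; split=> //; rewrite leey.
rewrite (expect_EFin mB PB)//.
by apply: bfunD; [exact: bfun_sqdist|exact: bfun_cst].
Qed.

Lemma power_dist2_var_fin (nu : 'I_k -> probability T R) x :
  (forall i, nu i (~` B) = 0%E) ->
  exists2 r : R, 0 <= r & power_dist2 (@mean R d \o nu) (@var R d \o nu) x = r%:E.
Proof.
move=> nuB; set p := power_dist2 _ _ _.
have p0 : (0 <= p)%E.
  apply/bigmin_geP; split => [|i _]; first by rewrite leey.
  rewrite /= (var_EFin (nuB i)) -EFinD lee_fin addr_ge0 ?sqr_ge0//.
  by apply: (expect_ge0 mB) => //; [exact: bfun_sqdist|move=> u _; rewrite sqr_ge0].
have py : (p < +oo)%E.
  apply: (le_lt_trans (bigmin_le _ (Ordinal k0) _)).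
  by rewrite /= (var_EFin (nuB _)) -EFinD ltry.
by move: p0 py; case: p => [r| |]// r0 _; exists r.
Qed.

Lemma OPT_pdtm theta : OPT P h k theta ->
  exists2 f, is_pdtm P h k f &
    forall x, (f x)%:E = sqrte (power_dist2 theta (omega2 P h \o theta) x).
Proof.
move=> opt; have [i fin] := OPT_finite opt.
have [s [nu [lnu E]]] := power_dist2_attained fin.
have riskE : risk P theta (omega2 P h \o theta) = risk P (@mean R d \o nu) (@var R d \o nu).
  by rewrite /risk; congr (integral _ _ _); apply/funext => x; rewrite E.
exists (fun x => Num.sqrt (fine (power_dist2 theta (omega2 P h \o theta) x))).
- have optnu : pdtm_optimal P h s nu.
    split; first exact: lnu.
    move=> s' nu' lnu'; rewrite -riskE.
    have -> : @var R d \o nu' = omega2 P h \o (@mean R d \o nu').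
      by apply/funext => j; apply/esym; exact: omega2_mean (lnu' j).
    exact: opt.
  exists s, nu; split; first exact: optnu.
  move=> x.
  split; first by rewrite sqrtr_ge0.
  have [r r0 rE] := power_dist2_var_fin x (fun i => subB (lnu i)).
  by rewrite -E rE /= sqr_sqrtr.
- move=> x; have [r r0 rE] := power_dist2_var_fin x (fun i => subB (lnu i)).
  by rewrite -E rE.
Qed.
End tuples.
End local_weights.

Unset Implicit Arguments.
Set Strict Implicit.

Theorem theorem17 (R : realType) (d : nat) (k : nat) (hk : (0 < k)%N)
    (P : probability (borel_rV R d) R) (h : R)
    (hP : (exists K : R, [/\ 0 < K, 0 < h, h <= 1 & regular_class K h P]) \/
          (exists (n q : nat) (p : 'I_n -> 'rV[R]_d),
             [/\ injective p, general_position p, uniform_on p P,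
                 (1 <= q <= n)%N & h = q%:R / n%:R])) :
  (forall f : 'rV[R]_d -> R, is_pdtm P h k f ->
     exists2 theta : 'I_k -> 'rV[R]_d, OPT P h k theta &
       forall x, ((f x) ^+ 2)%:E = power_dist2 theta (omega2 P h \o theta) x) /\
  (forall theta : 'I_k -> 'rV[R]_d, OPT P h k theta ->
     exists2 f : 'rV[R]_d -> R, is_pdtm P h k f &
       forall x, (f x)%:E = sqrte (power_dist2 theta (omega2 P h \o theta) x)).
Proof.
(* The two cases are reduced to what they share: [P] lives in a ball, and local measures at the same
   point at infinity with the same mean coincide. *)
have [K [PB h0 h1 uniq]] : exists K : R,
    [/\ P (~` (ecball 0 K%:E : set (borel_rV R d))) = 0%E, 0 < h, h <= 1 &
     forall v (mu mu' : probability (borel_rV R d) R),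
       local_probs P h (inr v) mu -> local_probs P h (inr v) mu' -> mean mu = mean mu' ->
       forall A, measurable A -> mu A = mu' A].
  case: hP => [[K [K0 h0 h1 [suppK _ Pbd]]]|[n [q [p [pinj gp unifP /andP[q1 qn] hE]]]]].
    have PB := supp_null (measurable_ecball 0 K%:E) suppK.
    exists K; split=> // v mu mu' lmu lmu' _.
    exact: (regular_halfspace_unique PB h0 h1 Pbd lmu lmu').
  have n0 : 0 < n%:R :> R by rewrite ltr0n (leq_trans q1).
  have h0 : 0 < h by rewrite hE divr_gt0// ltr0n.
  have h1 : h <= 1 by rewrite hE ler_pdivrMr// mul1r ler_nat.
  exists (\sum_i enorm (p i)); split => //; first exact: points_in_ball unifP.
  by move=> v mu mu'; exact: (general_position_halfspace_unique pinj unifP h0 h1 gp).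
split=> [f [s [mu [opt fE]]]|theta]; last exact: (OPT_pdtm PB h0 h1 uniq hk).
exists (@mean R d \o mu); first exact: (pdtm_OPT PB h0 h1 uniq opt).
move=> x; rewrite (fE x).2; congr power_dist2.
by apply/funext => i; rewrite /= (omega2_mean PB h0 h1 uniq (opt.1 i)).
Qed.
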